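(* Let $\Omega$ be a bounded pseudoconvex domain in $\mathbb C^n$. Suppose there exists a family $\{\Omega^t\}_{0<t\le t_0}$ of pseudoconvex domains in $\mathbb C^n$ such that $\overline\Omega\subset\Omega^t$ for all $t$ and $$\eta(t)\le\delta_{\Omega^t}(z)\le t\quad\text{for all } z\in\partial\Omega\text{ and all } t\in(0,t_0],$$ where $\eta$ is a continuous increasing function on $(0,t_0]$ with $0<\eta(t)<t$ satisfying $$\int_0^{r_0}\frac{dt}{t\,\log[t/\eta(t)]}=\infty$$ for some sufficiently small $r_0\in(0,t_0]$. Then $\Omega$ is hyperconvex.
   Context: For a domain $D\subset\mathbb C^n$ and $z\in D$, $\delta_D(z)=d(z,\partial D)$ is the Euclidean distance from $z$ to $\partial D$. A bounded domain $\Omega\subset\mathbb C^n$ is called hyperconvex if there exists a negative continuous plurisubharmonic function $\rho$ on $\Omega$ such that for every $c>0$ the set $\{z\in\Omega:\rho(z)<-c\}$ is relatively compact in $\Omega$. *)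

(* Defs.v *)
From HB Require Import structures.
From mathcomp Require Import all_boot all_order all_algebra.
From mathcomp Require Export complex.
From mathcomp Require Import all_classical all_reals all_analysis.

Set Implicit Arguments.
Unset Strict Implicit.
Unset Printing Implicit Defensive.

Import Order.TTheory GRing.Theory Num.Theory.
Import numFieldNormedType.Exports.

Local Open Scope classical_set_scope.
Local Open Scope ring_scope.
Local Open Scope complex_scope.

(* The usual topology on R[i], given by the modulus.  The libraries provide it
   for an abstract numFieldType only; with these instances, 'rV[R[i]]_n carries
   the product topology. *)
HB.instance Definition _ (R : rcfType) :=
  PseudoPointedMetric.copy R[i] R[i]^o.
HB.instance Definition _ (R : rcfType) := Vector.copy R[i] R[i]^o.
HB.instance Definition _ (R : rcfType) := NormedModule.copy R[i] R[i]^o.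

Section ComplexSpace.
Context {R : realType} {n : nat}.
Implicit Types (D A : set 'rV[R[i]]_n) (z b : 'rV[R[i]]_n).

(* The norm of the library on 'rV[R[i]]_n is the sup norm. *)
Definition euclidean_norm z : R :=
  Num.sqrt (\sum_(i < n) (complex.Re (z 0 i) ^+ 2 + complex.Im (z 0 i) ^+ 2)).

Definition is_domain D := [/\ D !=set0, open D & connected D].

Definition boundary D := closure D `\` interior D.

(* This is +oo when the boundary is empty, in particular for D = C^n. *)
Definition boundary_distance D z : \bar R :=
  ereal_inf [set (euclidean_norm (z - w))%:E | w in boundary D].

Definition relatively_compact_in A D :=
  compact (closure A) /\ closure A `<=` D.

End ComplexSpace.

Section Plurisubharmonic.
Local Open Scope ereal_scope.

Definition upper_semicontinuous_on {R : realType} {T : topologicalType}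
    (D : set T) (u : T -> \bar R) :=
  forall x, D x -> forall a : R, u x < a%:E ->
    \forall y \near within D (nbhs x), u y < a%:E.

(* The constant -oo is allowed.  On a circle in U, a function satisfying the
   first two conditions is bounded above, so that the integral below is well
   defined in [-oo, +oo[. *)
Definition subharmonic_on {R : realType} (U : set R[i]) (u : R[i] -> \bar R) :=
  [/\ upper_semicontinuous_on U u,
      (forall x, U x -> u x < +oo) &
      forall (c : R[i]) (r : R), (0 < r)%R ->
        (forall x : R[i], (`|x - c| <= r%:C)%R -> U x) ->
        u c <= ((2 * pi)^-1)%:E *
          \int[@lebesgue_measure R]_(theta in `[0%R, (2 * pi)%R])
            u (c + r%:C * (cos theta +i* sin theta))%R].

Definition plurisubharmonic_on {R : realType} {n : nat}
    (D : set 'rV[R[i]]_n) (u : 'rV[R[i]]_n -> \bar R) :=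
  [/\ upper_semicontinuous_on D u,
      (forall z, D z -> u z < +oo) &
      forall a b : 'rV[R[i]]_n,
        subharmonic_on [set x : R[i] | D (a + x *: b)%R]
                       (fun x : R[i] => u (a + x *: b)%R)].

(* Oka's definition: - log of the distance to the boundary is
   plurisubharmonic.  For D = C^n this function is the constant -oo. *)
Definition pseudoconvex {R : realType} {n : nat} (D : set 'rV[R[i]]_n) :=
  plurisubharmonic_on D (fun z => - lne (boundary_distance D z)).

End Plurisubharmonic.

Definition hyperconvex {R : realType} {n : nat} (Om : set 'rV[R[i]]_n) :=
  [/\ is_domain Om, bounded_set Om &
      exists rho : 'rV[R[i]]_n -> R,
        [/\ (forall z, Om z -> rho z < 0),
            {within Om, continuous rho},
            plurisubharmonic_on Om (fun z => (rho z)%:E) &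
            forall c : R, 0 < c ->
              relatively_compact_in [set z | Om z /\ rho z < - c] Om]].

(* Main.v *)
Require Import Defs.
From mathcomp Require Import all_boot all_order all_algebra.
From mathcomp Require Import all_classical all_reals all_analysis.
From mathcomp Require Import measurable_realfun ring lra.
Import Order.TTheory GRing.Theory Num.Theory.
Import numFieldNormedType.Exports.
Import complex.ComplexField.Normc.
Local Open Scope classical_set_scope.
Local Open Scope ring_scope.

(** The idea is to build a negative plurisubharmonic exhaustion of Om stage by stage,
    each stage improving the lower bound near the boundary by a definite factor.

    Let d and dt be the distances to the boundaries of Om and of Omt t. A segment from a
    point of Om to the boundary of Omt t crosses the boundary of Om, whence
    d + eta t <= dt <= d + t on Om (real_distance_super, real_distance_super_le). By
    pseudoconvexity
      w = (ln (eta t) - ln dt) / ln (4 t / eta t)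
    is plurisubharmonic on Om. It is negative because dt > eta t; it is at most - 1
    where d >= 4 t, because dt >= 4 t there; and it is at least
      - ln (2 t / eta t) / ln (4 t / eta t) = - (1 - ln 2 / (2 ln 2 + ln (t / eta t)))
    where d <= t, because dt <= 2 t there.

    Suppose that psi < 0 is plurisubharmonic on Om and at least - a where d <= 8 t. On
    4 t < d < 8 t one has a w <= - a <= psi, so the function equal to max (psi, a w)
    where d < 8 t and to psi elsewhere is plurisubharmonic (locally_psh_glue). It is
    still negative, and where d <= t it is at least
    - a (1 - ln 2 / (2 ln 2 + ln (t / eta t))). Starting from psi = - 1 and taking
    t = r0 / 8, r0 / 64 and so on, the sequence is eventually constant on each set
    where d is bounded below; its limit rho is at least - a_k near the boundary for
    every k, where a_k is a product of the factors above (glued_psh_exhaustion). Since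
    eta is nondecreasing, the divergence of the integral forces the divergence of the
    sum of ln 2 / (2 ln 2 + ln (t / eta t)) over that sequence
    (log_weight_unbounded), so a_k tends to 0 and rho is an exhaustion.

    Gluing only gives the sub-mean value inequality on small circles, whereas
    subharmonicity is defined by all circles. For continuous functions the passage from
    the former to the latter, submean_local_global, is deduced from the maximum
    principle by averaging over the rotations by the N-th roots of unity. *)

(** * The Euclidean norm and the topology of C^n *)

Section EuclideanNorm.
Context {R : realType} {n : nat}.
Implicit Types (z w v : 'rV[R[i]]_n) (x : R[i]).

Lemma euclidean_norm_ge0 z : 0 <= euclidean_norm z.
Proof. exact: sqrtr_ge0. Qed.

Lemma sqr_euclidean_norm z : euclidean_norm z ^+ 2 =
  \sum_(i < n) (complex.Re (z 0 i) ^+ 2 + complex.Im (z 0 i) ^+ 2).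
Proof. by rewrite sqr_sqrtr // sumr_ge0 // => i _; rewrite addr_ge0 // sqr_ge0. Qed.

Lemma normc_sqr x : (normc x) ^+ 2 = complex.Re x ^+ 2 + complex.Im x ^+ 2.
Proof. by case: x => a b /=; rewrite sqr_sqrtr // addr_ge0 // sqr_ge0. Qed.

Lemma normc_ge0 x : 0 <= normc x.
Proof. by case: x => a b; exact: sqrtr_ge0. Qed.

Lemma euclidean_normZ x z : euclidean_norm (x *: z) = normc x * euclidean_norm z.
Proof.
apply/eqP; rewrite -(eqrXn2 (n:=2)) ?euclidean_norm_ge0 ?mulr_ge0 ?normc_ge0 ?euclidean_norm_ge0 //.
rewrite exprMn !sqr_euclidean_norm normc_sqr mulr_sumr; apply/eqP/eq_bigr => i _.
rewrite mxE; case: x (z 0 i) => a b [c d] /=; ring.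
Qed.

Lemma euclidean_norm0 : euclidean_norm (0 : 'rV[R[i]]_n) = 0.
Proof. by rewrite -(scale0r (0 : 'rV[R[i]]_n)) euclidean_normZ normc0 mul0r. Qed.

Lemma euclidean_normN z : euclidean_norm (- z) = euclidean_norm z.
Proof.
by rewrite -scaleN1r euclidean_normZ normcN normc1 mul1r.
Qed.

Lemma euclidean_dist_sym z w : euclidean_norm (z - w) = euclidean_norm (w - z).
Proof. by rewrite -euclidean_normN opprB. Qed.

Lemma normc_le_euclidean_norm z i : normc (z 0 i) <= euclidean_norm z.
Proof.
rewrite -(@ler_pXn2r _ 2) ?nnegrE ?normc_ge0 ?euclidean_norm_ge0 //.
rewrite normc_sqr sqr_euclidean_norm (bigD1 i) //= lerDl sumr_ge0 // => j _.
by rewrite addr_ge0 // sqr_ge0.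
Qed.

Lemma euclidean_normD z w :
  euclidean_norm (z + w) <= euclidean_norm z + euclidean_norm w.
Proof.
pose dot := \sum_(i < n) (complex.Re (z 0 i) * complex.Re (w 0 i) +
                          complex.Im (z 0 i) * complex.Im (w 0 i)).
(* The form |a z + b w|^2 in (a, b) is nonnegative; suitable values of a and b
   then give the Cauchy-Schwarz inequality, also when a norm vanishes. *)
have dotE (a b : R) : 0 <= a ^+ 2 * euclidean_norm z ^+ 2 + (a * b * dot) *+ 2 +
    b ^+ 2 * euclidean_norm w ^+ 2.
  rewrite !sqr_euclidean_norm /dot mulr_sumr mulr_sumr -sumrMnl mulr_sumr -!big_split /=.
  apply: sumr_ge0 => i _.
  have -> : a ^+ 2 * (complex.Re (z 0 i) ^+ 2 + complex.Im (z 0 i) ^+ 2) +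
    (a * b * (complex.Re (z 0 i) * complex.Re (w 0 i) +
              complex.Im (z 0 i) * complex.Im (w 0 i))) *+ 2 +
    b ^+ 2 * (complex.Re (w 0 i) ^+ 2 + complex.Im (w 0 i) ^+ 2) =
    (a * complex.Re (z 0 i) + b * complex.Re (w 0 i)) ^+ 2 +
    (a * complex.Im (z 0 i) + b * complex.Im (w 0 i)) ^+ 2 by ring.
  by rewrite addr_ge0 // sqr_ge0.
have nz := euclidean_norm_ge0 z; have nw := euclidean_norm_ge0 w.
have CS : dot <= euclidean_norm z * euclidean_norm w.
  set A := euclidean_norm z in nz dotE *; set B := euclidean_norm w in nw dotE *.
  have [A0|A0] := eqVneq A 0.
    have := dotE (B ^+ 2 + 1) (- dot); rewrite A0 => h; nra.
  have [B0|B0] := eqVneq B 0.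
    have := dotE (- dot) (A ^+ 2 + 1); rewrite B0 => h; nra.
  have A1 : 0 < A by rewrite lt_def A0. have B1 : 0 < B by rewrite lt_def B0.
  have := dotE B (- A) => h.
  have : 0 <= A * B * (A * B - dot) by nra.
  by rewrite pmulr_rge0 ?mulr_gt0 // subr_ge0.
rewrite -(@ler_pXn2r _ 2) ?nnegrE ?addr_ge0 ?euclidean_norm_ge0 //.
rewrite sqr_euclidean_norm sqrrD !sqr_euclidean_norm.
have -> : \sum_(i < n) (complex.Re ((z + w) 0 i) ^+ 2 + complex.Im ((z + w) 0 i) ^+ 2) =
  \sum_(i < n) (complex.Re (z 0 i) ^+ 2 + complex.Im (z 0 i) ^+ 2) + dot *+ 2 +
  \sum_(i < n) (complex.Re (w 0 i) ^+ 2 + complex.Im (w 0 i) ^+ 2).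
  rewrite /dot -sumrMnl -!big_split /=; apply: eq_bigr => i _.
  rewrite mxE; case: (z 0 i) (w 0 i) => a b [c d] /=; ring.
by rewrite lerD2r lerD2l ler_wMn2r.
Qed.

Lemma euclidean_dist_triangle w z v :
  euclidean_norm (z - v) <= euclidean_norm (z - w) + euclidean_norm (w - v).
Proof. by apply: le_trans (euclidean_normD _ _); rewrite addrA subrK. Qed.

(** The radius of a ball of the library is a complex number; only real radii
    matter, and then the ball is a polydisc. *)
Lemma ball_rV_normcP z w (e : R) :
  ball z (e%:C)%C w <-> 0 < e /\ forall i, normc (z 0 i - w 0 i) < e.
Proof.
split.
  case; rewrite ltcR => e0 H; split=> // i.
  have := H 0 i; rewrite /ball /= normc_def ltcR.
  by case: (z 0 i - w 0 i).
case=> e0 H; split; first by rewrite ltcR.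
move=> i j; rewrite (ord1 i).
have := H j; rewrite /ball /= normc_def ltcR.
by case: (z 0 j - w 0 j).
Qed.

(** From here on neighbourhoods are handled through this characterization: an open
    polydisc and a Euclidean ball each contain a concentric copy of the other. *)
Lemma nbhs_euclideanP z (A : set 'rV[R[i]]_n) :
  nbhs z A <-> exists2 e : R, 0 < e & forall w, euclidean_norm (w - z) < e -> A w.
Proof.
split.
  move/nbhs_ballP => -[[e e'] /= ]; rewrite ltcE /= => /andP[/eqP-> e0] H.
  exists e => // w we; apply: H; apply/ball_rV_normcP; split=> // i.
  rewrite -normcN opprB; apply: le_lt_trans we.
  by have := normc_le_euclidean_norm (w - z) i; rewrite !mxE.
case=> e e0 H; apply/nbhs_ballP; exists (e / n.+1%:R)%:C%C => /=.
  by rewrite ltcR divr_gt0.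
move=> w /ball_rV_normcP [_ zw]; apply: H.
rewrite -(@ltr_pXn2r _ 2) ?nnegrE ?(ltW e0) ?euclidean_norm_ge0 // sqr_euclidean_norm.
apply: (@le_lt_trans _ _ (\sum_(i < n) (e / n.+1%:R) ^+ 2)).
  apply: ler_sum => i _; rewrite -normc_sqr ler_pXn2r ?nnegrE ?normc_ge0 //; last first.
    by rewrite divr_ge0 // ltW.
  by rewrite -normcN; have := zw i; rewrite !mxE opprB => /ltW.
rewrite sumr_const card_ord expr_div_n -[X in X < _]mulr_natr -mulrA.
rewrite gtr_pMr ?exprn_gt0 // mulrC ltr_pdivrMr ?exprn_gt0 // mul1r.
by rewrite -natrX ltr_nat expnS expn1 (leq_trans (ltnSn n)) // leq_pmulr.
Qed.

End EuclideanNorm.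

(** * Compactness and continuity in C^n *)

Section Compactness.
Context {R : realType}.

Lemma normc_le_abs (a b : R) : normc (a +i* b)%C <= `|a| + `|b|.
Proof.
rewrite -(@ler_pXn2r _ 2) ?nnegrE ?normc_ge0 ?addr_ge0 // normc_sqr /=.
rewrite sqrrD !real_normK ?num_real // -addrA lerD2l lerDr.
by rewrite mulrn_wge0 // mulr_ge0.
Qed.

Lemma continuous_Complex : continuous (fun p : R * R => (p.1 +i* p.2)%C).
Proof.
move=> [a b]; apply/cvgrPdist_lt => -[e e'] /= ; rewrite ltcE /= => /andP[/eqP-> e0].
have e2 : 0 < e / 2 by rewrite divr_gt0.
apply: filterS (nbhsx_ballx (a, b) _ e2) => p [/= ha hb]; rewrite normc_def ltcR.
apply: (@le_lt_trans _ _ (normc ((a - p.1) +i* (b - p.2))%C)) => //.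
by apply: le_lt_trans (normc_le_abs _ _) _; rewrite [e]splitr ltrD.
Qed.

(** C is handled as the image of R^2, where segments are compact. *)
Lemma compact_complex_square (M : R) :
  compact [set x : R[i] | `|complex.Re x| <= M /\ `|complex.Im x| <= M].
Proof.
have -> : [set x : R[i] | `|complex.Re x| <= M /\ `|complex.Im x| <= M] =
  (fun p : R * R => (p.1 +i* p.2)%C) @` (`[- M, M] `*` `[- M, M]).
  apply/seteqP; split=> [[a b] /= [ha hb]|_ [[a b] /= [ha hb] <-]].
    by exists (a, b) => //; split; rewrite /= in_itv /= -ler_norml.
  by move: ha hb; rewrite !in_itv /= -!ler_norml.
apply: continuous_compact.
  by apply: continuous_subspaceT; exact: continuous_Complex.
by apply: compact_setX; exact: segment_compact.
Qed.

(** Heine-Borel for C^n: Tychonoff applied to a product of n squares. *)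
Lemma compact_closed_bounded n (A : set 'rV[R[i]]_n) (M : R) :
  closed A -> (forall z, A z -> euclidean_norm z <= M) -> compact A.
Proof.
move=> cA bA.
have cB := @rV_compact _ n (fun _ => _) (fun _ => compact_complex_square M).
apply: subclosed_compact cA cB _ => z Az i /=.
have h : normc (z ord0 i) <= M := le_trans (normc_le_euclidean_norm z i) (bA z Az).
have M0 : 0 <= M := le_trans (normc_ge0 _) h.
move: h; rewrite -(@ler_pXn2r _ 2) ?nnegrE ?normc_ge0 // normc_sqr => h.
split; rewrite -(@ler_pXn2r _ 2) ?nnegrE // real_normK ?num_real //;
  apply: le_trans h; by [rewrite lerDl sqr_ge0 | rewrite lerDr sqr_ge0].
Qed.

Lemma bounded_euclidean n (A : set 'rV[R[i]]_n) : bounded_set A ->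
  exists M : R, forall z, A z -> euclidean_norm z <= M.
Proof.
case=> M0 [M0r H].
have /H{}H : M0 < M0 + 2 by rewrite ltrDl.
pose M := complex.Re (M0 + 2).
have ME : M0 + 2 = M%:C%C by rewrite /M RRe_real // rpredD // rpred_nat.
exists (\sum_(i < n) (M + 1) ^+ 2 + 1) => z Az.
have zM : ball 0 (M + 1)%:C%C z.
  rewrite mx_norm_ball /ball_ /= sub0r normrN; apply: le_lt_trans (H z Az) _.
  by rewrite ME ltcR ltrDl.
case/ball_rV_normcP : zM => M1 zM.
apply: (@le_trans _ _ (euclidean_norm z ^+ 2 + 1)).
  have := euclidean_norm_ge0 z; nra.
rewrite lerD2r sqr_euclidean_norm; apply: ler_sum => i _; rewrite -normc_sqr.
rewrite ler_pXn2r ?nnegrE ?normc_ge0 ?(ltW M1) //.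
by have := zM i; rewrite !mxE sub0r normcN => /ltW.
Qed.

End Compactness.

Section Continuity.
Context {R : realType} {n : nat}.
Implicit Types (f : 'rV[R[i]]_n -> R) (z w : 'rV[R[i]]_n).

Lemma continuous_euclideanP f z : {for z, continuous f} <->
  forall e : R, 0 < e -> exists2 d : R, 0 < d &
    forall w, euclidean_norm (w - z) < d -> `|f z - f w| < e.
Proof.
split=> [cf e e0|H].
  have /cvgrPdist_lt/(_ e e0) h : f @ z --> f z by exact: cf.
  by move/nbhs_euclideanP : h => [d d0 Hd]; exists d.
apply/(@cvgrPdist_lt _ _ _ (nbhs z) (nbhs_filter z) f (f z)) => e /H[d d0 Hd].
by apply/nbhs_euclideanP; exists d.
Qed.

Lemma nonexpansive_continuous f z :
  (forall w, `|f z - f w| <= euclidean_norm (w - z)) -> {for z, continuous f}.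
Proof.
by move=> H; apply/continuous_euclideanP => e e0; exists e => // w; exact: le_lt_trans.
Qed.

End Continuity.

(** * Means over circles *)

Lemma continuous_at_sum {R : realType} (T : topologicalType) N (f : nat -> T -> R) (x : T) :
  (forall k, (k < N)%N -> {for x, continuous (f k)}) ->
  {for x, continuous (fun t => \sum_(k < N) f k t)}.
Proof.
elim: N => [|N IH] cf.
  have -> : (fun t => \sum_(k < 0) f k t) = (fun=> 0) by apply/funext => t; rewrite big_ord0.
  exact: cst_continuous.
have -> : (fun t => \sum_(k < N.+1) f k t) = (fun t => \sum_(k < N) f k t + f N t).
  by apply/funext => t; rewrite big_ord_recr.
apply: continuousD; last exact: cf.
by apply: IH => k kN; apply: cf; rewrite ltnS ltnW.
Qed.

Section CircleMean.
Context {R : realType}.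
Notation mu := (@lebesgue_measure R).
Implicit Types (f g h : R -> R).

(** The real-valued form, for continuous functions, of the mean that defines
    subharmonicity. *)
Definition circle_mean h : R := (2 * pi)^-1 * \int[mu]_(t in `[0, 2 * pi]) h t.

Lemma twopi_gt0 : 0 < 2 * pi :> R.
Proof. by rewrite mulr_gt0 // pi_gt0. Qed.

Lemma continuous_integrable h (a b : R) : continuous h -> mu.-integrable `[a, b] (EFin \o h).
Proof.
move=> ch; apply: continuous_compact_integrable; first exact: segment_compact.
exact: continuous_subspaceT.
Qed.

Lemma circle_meanE h : continuous h ->
  (circle_mean h)%:E = (((2 * pi)^-1)%:E * \int[mu]_(t in `[0%R, (2 * pi)%R]) (h t)%:E)%E.
Proof.
move=> ch; rewrite /circle_mean EFinM; congr (_ * _)%E.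
by rewrite fineK // integrable_fin_num //; exact: continuous_integrable.
Qed.

Lemma circle_mean_le f g : continuous f -> continuous g ->
  (forall t, 0 <= t <= 2 * pi -> f t <= g t) -> circle_mean f <= circle_mean g.
Proof.
move=> cf cg fg; rewrite ler_pM2l ?invr_gt0 ?twopi_gt0 //.
apply: le_Rintegral => //;
  by [exact: continuous_integrable|move=> t /=; rewrite in_itv; exact: fg].
Qed.

Lemma eq_circle_mean f g : f =1 g -> circle_mean f = circle_mean g.
Proof. by move=> fg; rewrite /circle_mean; congr (_ * _); apply: eq_Rintegral => t _. Qed.

Lemma circle_mean_cst (c : R) : circle_mean (fun=> c) = c.
Proof.
rewrite /circle_mean Rintegral_cst //= lebesgue_measure_itv /= lte_fin twopi_gt0.
by rewrite -EFinB /= subr0 mulrCA mulVf ?mulr1 // gt_eqF // twopi_gt0.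
Qed.

Lemma circle_meanD f g : continuous f -> continuous g ->
  circle_mean (fun t => f t + g t) = circle_mean f + circle_mean g.
Proof.
move=> cf cg; rewrite /circle_mean RintegralD //; try exact: continuous_integrable.
by rewrite mulrDr.
Qed.

Lemma circle_meanZ (c : R) f : continuous f ->
  circle_mean (fun t => c * f t) = c * circle_mean f.
Proof.
by move=> cf; rewrite /circle_mean RintegralZl //; [rewrite mulrCA|exact: continuous_integrable].
Qed.

Lemma circle_mean_sum N (f : nat -> R -> R) : (forall k, continuous (f k)) ->
  circle_mean (fun t => \sum_(k < N) f k t) = \sum_(k < N) circle_mean (f k).
Proof.
move=> cf; elim: N => [|N IH].
  by rewrite big_ord0 -[RHS](circle_mean_cst 0); apply: eq_circle_mean => t; rewrite big_ord0.
rewrite big_ord_recr /= -IH -circle_meanD //.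
  by apply: eq_circle_mean => t; rewrite big_ord_recr.
by move=> t; apply: continuous_at_sum => k _; exact: cf.
Qed.

Lemma circle_mean_cos : circle_mean cos = 0.
Proof.
have := @continuous_FTC2 R cos sin 0 (2 * pi) twopi_gt0.
rewrite sin0 mulr_natl sin2pi subee // -mulr_natl => H.
apply/EFin_inj; rewrite circle_meanE; last exact: continuous_cos.
rewrite H ?mule0 //.
- exact/continuous_subspaceT/continuous_cos.
- split.
  + by move=> x _; exact: derivable_sin.
  + by apply: cvg_at_right_filter; exact: continuous_sin.
  + by apply: cvg_at_left_filter; exact: continuous_sin.
- by move=> x _; rewrite derive1E; apply: derive_val.
Qed.

Lemma circle_mean_sin : circle_mean sin = 0.
Proof.
have := @continuous_FTC2 R sin (- cos) 0 (2 * pi) twopi_gt0.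
rewrite !fctE cos0 mulr_natl cos2pi subee // -mulr_natl => H.
apply/EFin_inj; rewrite circle_meanE; last exact: continuous_sin.
rewrite H ?mule0 //.
- exact/continuous_subspaceT/continuous_sin.
- split.
  + by move=> x _; apply: derivableN; exact: derivable_cos.
  + by apply: cvg_at_right_filter; apply: cvgN; exact: continuous_cos.
  + by apply: cvg_at_left_filter; apply: cvgN; exact: continuous_cos.
- by move=> x _; rewrite derive1E deriveN ?derive_val ?opprK.
Qed.

(* Riemann sums *)
(** A step function below h, written for a uniform subdivision so that its integral
    is a Riemann sum. *)
Lemma Rintegral_steps h (d : R) (c : nat -> R) N : continuous h -> 0 < d ->
  (forall k t, (k < N)%N -> k%:R * d <= t <= k.+1%:R * d -> c k <= h t) ->
  \sum_(k < N) c k * d <= \int[mu]_(t in `[0, N%:R * d]) h t.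
Proof.
move=> ch d0; elim: N => [|N IH] H.
  by rewrite big_ord0 mul0r set_itv1 Rintegral_set1.
rewrite big_ord_recr /=.
have N0 : 0 <= N%:R * d by rewrite mulr_ge0 // ltW.
have NS : N%:R * d <= N.+1%:R * d by rewrite ler_pM2r // ler_nat.
have := @Rintegral_itvB R h (BLeft 0) (BRight (N.+1%:R * d)) (N%:R * d)
  (@continuous_integrable h _ _ ch).
rewrite !bnd_simp => /(_ N0 NS)/eqP; rewrite subr_eq => /eqP ->.
rewrite addrC lerD //; last by apply: IH => k t kN; apply: H; rewrite ltnS ltnW.
have -> : c N * d = \int[mu]_(t in `]N%:R * d, N.+1%:R * d]) c N.
  rewrite Rintegral_cst //= lebesgue_measure_itv /= lte_fin ltr_pM2r // ltr_nat ltnSn.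
  by rewrite -EFinB /= -natr1 mulrDl mul1r [_ + d]addrC addrK.
apply: le_Rintegral => //.
- apply: (@integrableS _ _ _ mu `[N%:R * d, N.+1%:R * d]) => //.
    exact: subset_itv_oc_cc.
  by apply: (@continuous_integrable (fun=> c N)); exact: cst_continuous.
- apply: (@integrableS _ _ _ mu `[N%:R * d, N.+1%:R * d]) => //.
    exact: subset_itv_oc_cc.
  exact: continuous_integrable.
- move=> t /=; rewrite in_itv /= => /andP[/ltW a b]; apply: H => //.
  by rewrite a b.
Qed.

End CircleMean.

(** * The unit circle and polar coordinates *)

Section UnitCircle.
Context {R : realType}.
Implicit Types (x y : R[i]) (s t : R).

Definition cis t : R[i] := (cos t +i* sin t)%C.

Lemma cis0 : cis 0 = 1.
Proof. by rewrite /cis cos0 sin0. Qed.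

Lemma cisD s t : cis (s + t) = cis s * cis t.
Proof. by rewrite /cis cosD sinD; congr Complex; rewrite addrC mulrC. Qed.

Lemma cis2pi : cis (2 * pi) = 1.
Proof. by rewrite /cis mulr_natl cos2pi sin2pi. Qed.

Lemma normc_cis t : normc (cis t) = 1.
Proof. by rewrite /= cos2Dsin2 sqrtr1. Qed.

Lemma normcR (r : R) : normc (r%:C)%C = `|r|.
Proof. by rewrite /= expr0n addr0 sqrtr_sqr. Qed.

Lemma continuous_cis : continuous cis.
Proof.
move=> t; rewrite /cis.
have h1 : {for t, continuous (fun t : R => (cos t, sin t))}.
  exact: (cvg_pair (@continuous_cos R t) (@continuous_sin R t)).
exact: (continuous_comp h1 (@continuous_Complex R (cos t, sin t))).
Qed.

(** The angle is the arc cosine of the normalized real part, reflected when the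
    imaginary part is negative. *)
Lemma polar x : exists2 t, 0 <= t <= 2 * pi & x = (normc x)%:C%C * cis t.
Proof.
have [->|x0] := eqVneq x 0.
  by exists 0; rewrite ?lexx ?ltW ?twopi_gt0 // normc0 mul0r.
have r0 : 0 < normc x.
  by rewrite lt_def normc_ge0 andbT; apply: contra x0 => /eqP/eq0_normc/eqP.
have rE := normc_sqr x.
case: x x0 r0 rE => a b x0; set r := normc _ => r0 /= rE.
have a1 : -1 <= a / r <= 1.
  rewrite ler_pdivlMr // ler_pdivrMr // mul1r mulN1r -ler_norml.
  by rewrite -(@ler_pXn2r _ 2) ?nnegrE ?(ltW r0) // real_normK ?num_real // rE lerDl sqr_ge0.
have ca : cos (acos (a / r)) = a / r by apply: acosK; rewrite in_itv.
have sa : sin (acos (a / r)) = `|b| / r.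
  rewrite sin_acos // -[RHS]ger0_norm ?divr_ge0 // ?ltW // -sqrtr_sqr; congr Num.sqrt.
  rewrite !expr_div_n real_normK ?num_real // -[1](@divff _ (r ^+ 2)) ?gt_eqF ?exprn_gt0 //.
  by rewrite -mulrBl rE addrC addKr.
have rr (c : R) : r * (c / r) = c by rewrite mulrCA divff ?mulr1 // gt_eqF.
have [b0|b0] := leP 0 b.
  exists (acos (a / r)).
    by rewrite acos_ge0 //= (le_trans (acos_lepi a1)) // mulr_natl mulr2n lerDl pi_ge0.
  rewrite /cis ca sa ger0_norm //; apply/eqP; rewrite eq_complex /= !mul0r subr0 addr0.
  by rewrite !rr !eqxx.
exists (2 * pi - acos (a / r)).
  have := acos_lepi a1; have := acos_ge0 a1; lra.
rewrite /cis cosB sinB mulr_natl cos2pi sin2pi ca sa ltr0_norm //.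
by congr Complex; [rewrite -{1}(rr a)|rewrite -{1}(rr b)]; ring.
Qed.

End UnitCircle.

(** * The maximum principle on the unit disc *)

Section LocalGlobal.
Context {R : realType}.

(** Heine's theorem, in the one-sided form that allows t to leave the segment. *)
Lemma uniform_continuity_segment (h : R -> R) (a b e : R) : continuous h -> 0 < e ->
  exists2 d : R, 0 < d & forall s t, a <= s <= b -> `|s - t| < d -> `|h s - h t| < e.
Proof.
move=> ch e0.
pose P (d s : R) := forall t, `|s - t| < d -> `|h s - h t| < e.
have e2 : 0 < e / 2 by rewrite divr_gt0.
have cov : \forall d \near 0^'+, `[a, b] `<=` P d.
  move/compact_near_coveringP : (@segment_compact R a b); apply => s _.
  have /cvgrPdist_lt/(_ _ e2)/nbhs_ballP[d /= d0 Hd] : h t @[t --> s] --> h s := ch s.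
  have d2 : 0 < d / 2 by rewrite divr_gt0.
  exists (ball s (d / 2), [set r : R | r < d / 2]).
    by split=> /=; [exact: nbhsx_ballx|exact: nbhs_right_lt].
  move=> [s' r] /= [ss' rd] t tr.
  have ss : `|s - s'| < d / 2 by exact: ss'.
  have h1 : `|h s - h s'| < e / 2.
    by apply: Hd; rewrite /ball /= (lt_trans ss) // gtr_pMr // invf_lt1 // ltr1n.
  have h2 : `|h s - h t| < e / 2.
    apply: Hd; rewrite /ball /= [d]splitr -(subrK s' s) -addrA.
    by rewrite (le_lt_trans (ler_normD _ _)) // ltrD // (lt_trans tr).
  rewrite [e]splitr -(subrK (h s) (h s')) -addrA.
  by rewrite (le_lt_trans (ler_normD _ _)) // ltrD // distrC.
have [d [d0 dP]] : exists d : R, 0 < d /\ `[a, b] `<=` P d.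
  have : \forall d \near (0:R)^'+, 0 < d /\ `[a, b] `<=` P d.
    by near=> d; split; near: d => //; exact: nbhs_right_gt.
  by case/filter_ex => d; exists d.
exists d => // s t sab; apply: dP.
by rewrite /= in_itv.
Unshelve. all: by end_near. Qed.

Lemma continuous_circle (c : R[i]) (r t : R) :
  {for t, continuous (fun t => c + r%:C%C * cis t)}.
Proof.
have -> : (fun t => c + r%:C%C * cis t) = (fun p : R * R => (p.1 +i* p.2)%C) \o
    (fun t => (complex.Re c + r * cos t, complex.Im c + r * sin t)).
  by apply/funext => s; case: c => a b; congr Complex; rewrite /= mul0r ?subr0 ?addr0.
apply: continuous_comp; last exact: continuous_Complex.
have h1 : complex.Re c + r * cos s @[s --> t] --> complex.Re c + r * cos t.
  by apply: cvgD; [exact: cvg_cst|apply: cvgMr; exact: continuous_cos].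
have h2 : complex.Im c + r * sin s @[s --> t] --> complex.Im c + r * sin t.
  by apply: cvgD; [exact: cvg_cst|apply: cvgMr; exact: continuous_sin].
exact: (cvg_pair h1 h2).
Qed.

Lemma continuous_polar (p : R * R) : {for p, continuous (fun p : R * R => p.1%:C%C * cis p.2)}.
Proof.
have -> : (fun p : R * R => p.1%:C%C * cis p.2) = (fun p : R * R => (p.1 +i* p.2)%C) \o
    (fun p => (p.1 * cos p.2, p.1 * sin p.2)).
  by apply/funext => -[s t]; congr Complex; rewrite /= mul0r ?subr0 ?addr0.
apply: continuous_comp; last exact: continuous_Complex.
have h2 : q.2 @[q --> p] --> p.2 by exact: cvg_snd.
have h1 : q.1 @[q --> p] --> p.1 by exact: cvg_fst.
exact: (cvg_pair (cvgM h1 (continuous_comp h2 (@continuous_cos R p.2)))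
                 (cvgM h1 (continuous_comp h2 (@continuous_sin R p.2)))).
Qed.

Lemma normc_circle (x : R[i]) (r t : R) : normc (x + r%:C%C * cis t) ^+ 2 =
  normc x ^+ 2 + r ^+ 2 + r * 2 * (complex.Re x * cos t + complex.Im x * sin t).
Proof.
rewrite !normc_sqr; case: x => a b /=.
transitivity (a ^+ 2 + b ^+ 2 + r ^+ 2 * (cos t ^+ 2 + sin t ^+ 2) +
  r * 2 * (a * cos t + b * sin t)).
  by ring.
by rewrite cos2Dsin2 mulr1.
Qed.

(** Adding e |x|^2 makes the sub-mean value inequality strict, so the maximum over the
    closed disc, which exists by compactness of the rectangle of polar coordinates,
    cannot be attained inside; on the circle the perturbation costs at most e. *)
Lemma disc_max_principle (M : R[i] -> R) (e : R) : 0 < e ->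
  (forall x, normc x <= 1 -> {for x, continuous M}) ->
  (forall x, normc x < 1 -> exists r : R, [/\ 0 < r, normc x + r <= 1 &
     M x <= circle_mean (fun t => M (x + r%:C%C * cis t))]) ->
  exists2 t, 0 <= t <= 2 * pi & M 0 <= M (cis t) + e.
Proof.
move=> e0 cM sM.
pose F (p : R * R) := M (p.1%:C%C * cis p.2) + e * p.1 ^+ 2.
pose K := `[0 : R, 1] `*` `[0 : R, 2 * pi].
have pi0 := @twopi_gt0 R.
have K00 : K (0, 0) by split; rewrite /= in_itv /= lexx ?ler01 ?ltW.
have nK p : K p -> normc (p.1%:C%C * cis p.2) = p.1.
  case=> p1 _; have {p1}/andP[p0 _] : 0 <= p.1 <= 1 by move: p1; rewrite /= in_itv.
  by rewrite normcM normc_cis mulr1 normcR ger0_norm.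
have cF : {within K, continuous F}.
  apply: continuous_in_subspaceT => p /[!inE] Kp; apply: cvgD.
    apply: (@continuous_comp _ _ _ (fun p : R * R => p.1%:C%C * cis p.2) M).
      exact: continuous_polar.
    by apply: cM; rewrite nK //; case: Kp => /=; rewrite in_itv => /andP[].
  apply: cvgMr; apply: (@continuous_comp _ _ _ fst (fun x : R => x ^+ 2)); first exact: cvg_fst.
  exact: exprn_continuous.
have [|[s0 t0]] := compact_EVT_max (ex_intro _ _ K00) _ cF.
  by apply: compact_setX; exact: segment_compact.
rewrite inE => Kst Fmax.
have [/= /itvP s01 /itvP t02] := Kst.
have Fdisc x : normc x <= 1 -> M x + e * normc x ^+ 2 <= F (s0, t0).
  move=> x1; have [t t02' xE] := polar x.
  rewrite {1}xE; apply: (Fmax (normc x, t)); rewrite inE; split; rewrite /= in_itv //=.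
  by rewrite normc_ge0 x1.
have [s1|s1] := ltP s0 1; last first.
  have s0E : s0 = 1 by apply/eqP; rewrite eq_le s1 s01.
  exists t0; first by rewrite !t02.
  by have := Fdisc 0; rewrite normc0 ler01 /F s0E /= expr1n expr0n mulr0 addr0 mul1r mulr1; exact.
exfalso.
set x0 := s0%:C%C * cis t0.
have nx0 : normc x0 = s0 := nK (s0, t0) Kst.
have [|r [r0 xr1 Mr]] := sM x0; first by rewrite nx0.
have nxr t : normc (x0 + r%:C%C * cis t) <= 1.
  apply: le_trans xr1; apply: le_trans (le_normcD _ _) _.
  by rewrite lerD2l normcM normc_cis normcR mulr1 gtr0_norm.
(* M + e |x|^2 is at most its value at x0, and |x0 + r cis t|^2 exceeds |x0|^2 by
   r^2 plus a combination of cos t and sin t, whose mean is zero. *)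
pose G t := M x0 - e * r ^+ 2 +
  (- (e * r * 2 * complex.Re x0) * cos t + - (e * r * 2 * complex.Im x0) * sin t).
have MG t : M (x0 + r%:C%C * cis t) <= G t.
  rewrite /G; have -> : M x0 = F (s0, t0) - e * s0 ^+ 2 by rewrite /F addrK.
  by have := Fdisc _ (nxr t); rewrite normc_circle nx0; lra.
have cc a : continuous (fun t : R => a * cos t) by move=> t; apply: cvgMr; exact: continuous_cos.
have cs a : continuous (fun t : R => a * sin t) by move=> t; apply: cvgMr; exact: continuous_sin.
have cG : continuous G.
  by move=> t; apply: cvgD; [exact: cvg_cst|apply: cvgD; [exact: cc|exact: cs]].
have cMr : continuous (fun t => M (x0 + r%:C%C * cis t)).
  move=> t; apply: (@continuous_comp _ _ _ (fun t : R => x0 + r%:C%C * cis t) M);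
    [exact: continuous_circle|exact: cM].
have := le_trans Mr (circle_mean_le _ _ cMr cG (fun t _ => MG t)).
rewrite /G circle_meanD; [|exact: cst_continuous|by move=> t; apply: cvgD; [exact: cc|exact: cs]].
rewrite circle_mean_cst circle_meanD; [|exact: cc|exact: cs].
rewrite (circle_meanZ _ cos) ?(circle_meanZ _ sin); [|exact: continuous_sin|exact: continuous_cos].
rewrite circle_mean_cos circle_mean_sin !mulr0 !addr0.
have : 0 < e * r ^+ 2 by rewrite mulr_gt0 // exprn_gt0.
lra.
Qed.

End LocalGlobal.

(** * The sub-mean value inequality: from small circles to all circles *)

Section Submean.
Context {R : realType} {n : nat}.
Implicit Types (u : 'rV[R[i]]_n -> R) (a v y : 'rV[R[i]]_n).

(** The sub-mean value inequality on the circle with centre y and complex radius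
    vector v. As v ranges over all of C^n, this covers the rotated circles that appear
    when u is averaged over rotations. *)
Definition submean u y v := u y <= circle_mean (fun t => u (y + cis t *: v)).

Lemma continuous_slice u a v (c x : R[i]) : {for a + (c * x) *: v, continuous u} ->
  {for x, continuous (fun x => u (a + (c * x) *: v))}.
Proof.
move=> cu; apply: (@continuous_comp _ _ _ (fun x : R[i] => a + (c * x) *: v) u) => //.
move=> A /nbhs_euclideanP[e e0 HA].
pose L := normc c * euclidean_norm v.
have L0 : 0 <= L by rewrite mulr_ge0 ?normc_ge0 ?euclidean_norm_ge0.
have d0 : 0 < (e / (L + 1))%:C%C by rewrite ltcR divr_gt0 // ltr_wpDl.
apply: filterS (nbhsx_ballx x _ d0) => y.
rewrite /ball /= normc_def ltcR => xy; apply: HA.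
have -> : a + (c * y) *: v - (a + (c * x) *: v) = (c * (y - x)) *: v.
  by rewrite opprD addrACA subrr add0r -scalerBl mulrBr.
rewrite euclidean_normZ normcM mulrAC -/L.
have {}xy : normc (y - x) < e / (L + 1) by rewrite -normcN opprB; case: (x - y) xy.
apply: (@le_lt_trans _ _ (L * (e / (L + 1)))); first by rewrite ler_wpM2l // ltW.
by rewrite mulrA ltr_pdivrMr ?ltr_wpDl // mulrC ltr_pM2l // ltrDl.
Qed.

Lemma continuous_circle_slice u a v : (forall t, {for a + cis t *: v, continuous u}) ->
  continuous (fun t => u (a + cis t *: v)).
Proof.
move=> cu t; apply: (@continuous_comp _ _ _ cis (fun x : R[i] => u (a + x *: v))).
  exact: continuous_cis.
have -> : (fun x : R[i] => u (a + x *: v)) = (fun x => u (a + (1 * x) *: v)).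
  by apply/funext => x; rewrite mul1r.
by apply: continuous_slice; rewrite mul1r.
Qed.

(** Averaging x |-> u (a + x v) over the rotations by multiples of 2 pi / N gives a
    function M with M 0 = u a that still satisfies the inequality on small circles. By
    the maximum principle u a is at most some value of M on the unit circle, up to a
    small error; that value is a Riemann sum, with N nodes, of the integral of
    t |-> u (a + cis t v), which is close to the mean by uniform continuity. *)
Lemma submean_local_global (Om : set 'rV[R[i]]_n) u :
  (forall y, Om y -> {for y, continuous u}) ->
  (forall y, Om y -> exists2 e : R, 0 < e & forall v, euclidean_norm v < e -> submean u y v) ->
  forall a v, (forall x : R[i], normc x <= 1 -> Om (a + x *: v)) -> submean u a v.
Proof.
move=> cu lu a v aD.
pose h t := u (a + cis t *: v).
have ch : continuous h.
  by apply: continuous_circle_slice => t; apply/cu/aD; rewrite normc_cis.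
apply/ler_addgt0Pl => e e0.
have e2 : 0 < e / 2 by rewrite divr_gt0.
have pi0 := @twopi_gt0 R.
have [d d0 hd] := uniform_continuity_segment h 0 (2 * pi) (e / 2) ch e2.
pose m := Num.truncn (2 * pi / d); pose N := m.+1.
have N0 : 0 < N%:R :> R by rewrite ltr0n.
pose D : R := 2 * pi / N%:R.
have D0 : 0 < D by rewrite divr_gt0.
have ND : N%:R * D = 2 * pi by rewrite /D mulrCA divff ?mulr1 // gt_eqF.
have Dd : D < d.
  by rewrite ltr_pdivrMr // [d * _]mulrC -ltr_pdivrMr // truncnS_gt.
pose M (x : R[i]) := N%:R^-1 * \sum_(k < N) u (a + (cis (k%:R * D) * x) *: v).
have nw (k : nat) (x : R[i]) : normc (cis (k%:R * D) * x) = normc x.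
  by rewrite normcM normc_cis mul1r.
have cM (x : R[i]) : normc x <= 1 -> {for x, continuous M}.
  move=> x1.
  have hs : {for x, continuous (fun x => \sum_(k < N) u (a + (cis (k%:R * D) * x) *: v))}.
    apply: (continuous_at_sum _ N (fun (k : nat) x => u (a + (cis (k%:R * D) * x) *: v))) => k _.
    by apply: continuous_slice; apply/cu/aD; rewrite nw.
  exact: (@cvgMl_tmp R _ (nbhs x) _ _ N%:R^-1 _ hs).
have M0 : M 0 = u a.
  rewrite /M (eq_bigr (fun=> u a)); last by move=> k _; rewrite mulr0 scale0r addr0.
  by rewrite sumr_const card_ord -[u a *+ N]mulr_natl mulKf // gt_eqF.
have sM x : normc x < 1 -> exists r : R, [/\ 0 < r, normc x + r <= 1 &
     M x <= circle_mean (fun t => M (x + r%:C%C * cis t))].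
  move=> x1.
  have /choice[E HE] : forall k : nat, exists e : R, 0 < e /\ forall v0, euclidean_norm v0 < e ->
       submean u (a + (cis (k%:R * D) * x) *: v) v0.
    move=> k; have [|e1 e10 He] := lu (a + (cis (k%:R * D) * x) *: v).
      by apply: aD; rewrite nw ltW.
    by exists e1.
  (* One radius serves all N rotated centres. *)
  have [r [r0 rx rE]] : exists r : R, [/\ 0 < r, r <= 1 - normc x &
     forall k, (k < N)%N -> r * euclidean_norm v < E k].
    elim: (N) => [|j [r [r0 rx rE]]].
      by exists (1 - normc x); rewrite subr_gt0.
    have nv := euclidean_norm_ge0 v.
    exists (Num.min r (E j / (euclidean_norm v + 1))); split.
    - by rewrite lt_min r0 divr_gt0 ?(HE j).1 // ltr_wpDl.
    - by rewrite ge_min rx.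
    move=> k; rewrite ltnS leq_eqVlt => /predU1P[->|kj]; last first.
      by apply: le_lt_trans (rE k kj); rewrite ler_wpM2r // ge_min lexx.
    apply: (@le_lt_trans _ _ (E j / (euclidean_norm v + 1) * euclidean_norm v)).
      by rewrite ler_wpM2r // ge_min lexx orbT.
    by rewrite mulrAC ltr_pdivrMr ?ltr_wpDl // ltr_pM2l ?(HE j).1 // ltrDl.
  exists r; split=> //; first by rewrite -lerBrDl.
  have cuk (k : nat) : continuous (fun t => u (a + (cis (k%:R * D) * (x + r%:C%C * cis t)) *: v)).
    move=> t; apply: (@continuous_comp _ _ _ (fun t : R => x + r%:C%C * cis t)
      (fun x => u (a + (cis (k%:R * D) * x) *: v))); first exact: continuous_circle.
    apply: continuous_slice; apply/cu/aD; rewrite nw.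
    apply: (@le_trans _ _ (normc x + r)); last by rewrite -lerBrDl.
    apply: le_trans (le_normcD _ _) _.
    by rewrite lerD2l normcM normc_cis normcR mulr1 gtr0_norm.
  have cS : continuous (fun t => \sum_(k < N) u (a + (cis (k%:R * D) * (x + r%:C%C * cis t)) *: v)).
    by move=> t; exact: (continuous_at_sum _ N _ t (fun k _ => cuk k t)).
  rewrite /M (circle_meanZ _ _ cS).
  rewrite ler_pM2l ?invr_gt0 // (circle_mean_sum N _ cuk).
  apply: ler_sum => k _.
  have := (HE k).2 ((cis (k%:R * D) * r%:C%C) *: v).
  rewrite euclidean_normZ normcM normc_cis mul1r normcR gtr0_norm // => /(_ (rE k (ltn_ord k))).
  rewrite /submean => /le_trans; apply; rewrite le_eqVlt; apply/orP; left; apply/eqP.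
  apply: eq_circle_mean => t; congr (u _).
  by rewrite scalerA -addrA -scalerDl; congr (_ + _ *: _); ring.
have [t /andP[t0 _]] := disc_max_principle M (e / 2) e2 cM sM.
rewrite M0 => uM.
(* M is invariant under the rotation by D, so the angle of the maximum may be
   reduced to [0, D), where the nodes fall in the successive subintervals. *)
have MD x : M (cis D * x) = M x.
  rewrite /M; congr (_ * _).
  pose g (k : nat) := u (a + (cis (k%:R * D) * x) *: v).
  rewrite (eq_bigr (fun k : 'I_N => g k.+1)); last first.
    by move=> k _; rewrite /g -natr1 mulrDl mul1r cisD mulrA.
  have : \sum_(k < N.+1) g k = g 0%N + \sum_(k < N) g k.+1.
    by rewrite big_ord_recl; congr (_ + _); apply: eq_bigr => k _; rewrite lift0.
  rewrite big_ord_recr /= => /esym; rewrite [in X in _ = X -> _]addrC.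
  have -> : g N = g 0%N by rewrite /g ND cis2pi mul0r cis0.
  exact: addrI.
have MDj (j : nat) x : M (cis (j%:R * D) * x) = M x.
  elim: j => [|j IH]; first by rewrite mul0r cis0 mul1r.
  by rewrite -natr1 mulrDl mul1r addrC cisD -mulrA MD.
pose j := Num.truncn (t / D); pose b := t - j%:R * D.
have /andP[b0 bD] : 0 <= b < D.
  have tD : 0 <= t / D by rewrite divr_ge0 // ltW.
  have /andP[j1 j2] := truncn_itv tD.
  move: j1 j2; rewrite ler_pdivlMr // ltr_pdivrMr // -natr1 mulrDl mul1r => j1 j2.
  by rewrite subr_ge0 j1 ltrBlDl.
have Mb : M (cis t) = M (cis b).
  by rewrite -(MDj j (cis b)) -cisD /b addrC subrK.
have key : \sum_(k < N) (h (k%:R * D + b) - e / 2) * D <=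
    \int[lebesgue_measure]_(s in `[0, N%:R * D]) h s.
  apply: (@Rintegral_steps _ h D (fun k => h (k%:R * D + b) - e / 2)) => // k s kN /andP[s1 s2].
  have sk : s <= k%:R * D + D by move: s2; rewrite -natr1 mulrDl mul1r.
  have : `|h s - h (k%:R * D + b)| < e / 2.
    apply: hd; last by rewrite ltr_norml; apply/andP; split; lra.
    apply/andP; split; first by rewrite (le_trans _ s1) // mulr_ge0 // ltW.
    by rewrite (le_trans s2) // -ND ler_pM2r // ler_nat.
  rewrite ltr_norml => /andP[h1 h2]; lra.
have : M (cis b) - e / 2 <= circle_mean h.
  have ND0 : 0 < N%:R * D by rewrite mulr_gt0.
  rewrite /circle_mean -ND [leRHS]mulrC ler_pdivlMr //; apply: le_trans key.
  rewrite -mulr_suml sumrB sumr_const card_ord -[_ *+ N]mulr_natl /M.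
  rewrite (eq_bigr (fun k : 'I_N => h (k%:R * D + b))); last first.
    by move=> k _; rewrite /h (cisD _ b).
  rewrite le_eqVlt; apply/orP; left; apply/eqP; field.
  by rewrite gt_eqF.
rewrite -Mb -/h => hM; have := lerD uM hM; rewrite /h; lra.
Qed.

End Submean.

(** * Distance to the boundary *)

Section BoundaryDistance.
Context {R : realType} {n : nat}.
Implicit Types (D : set 'rV[R[i]]_n) (z w p : 'rV[R[i]]_n).

(** The last point of the segment that is a limit of points of D, found as a
    supremum, is on the boundary. *)
Lemma segment_meets_boundary D z w : D z -> ~ D w ->
  exists2 l : R, 0 <= l <= 1 & boundary D (z + l%:C%C *: (w - z)).
Proof.
move=> Dz Dw; pose q (l : R) := z + l%:C%C *: (w - z).
pose S := [set l : R | 0 <= l <= 1 /\ D (q l)].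
have q0 : q 0 = z by rewrite /q scale0r addr0.
have q1 : q 1 = w by rewrite /q scale1r addrC subrK.
have S0 : S 0 by rewrite /S /= q0 lexx ler01.
have supS : has_sup S by split; [exists 0|exists 1 => l [/andP[]]].
pose L := sup S.
have L0 : 0 <= L by apply: sup_upper_bound.
have L1 : L <= 1 by apply: sup_le_ub; [exists 0|move=> l [/andP[]]].
pose C := euclidean_norm (w - z) + 1.
have C0 : 0 < C by rewrite ltr_wpDl // euclidean_norm_ge0.
have qd (l l' e : R) : 0 < e -> `|l - l'| < e / C -> euclidean_norm (q l - q l') < e.
  move=> e0; rewrite ltr_pdivlMr // => h.
  have -> : q l - q l' = (l - l')%:C%C *: (w - z).
    by rewrite /q opprD addrACA subrr add0r -scalerBl rmorphB.
  rewrite euclidean_normZ normcR; apply: le_lt_trans h.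
  by rewrite ler_wpM2l // /C lerDl.
exists L; first by rewrite L0.
split.
  move=> B /nbhs_euclideanP[e e0 He].
  have eC : 0 < e / C by rewrite divr_gt0.
  have [l Sl ll] := sup_adherent eC supS.
  have lL : l <= L by apply: sup_upper_bound.
  exists (q l); split; first by case: Sl.
  by apply/He/qd => //; rewrite distrC ger0_norm ?subr_ge0 // ltrBlDr -ltrBlDl.
rewrite /interior => /nbhs_euclideanP[e e0 He].
have LN1 : L < 1.
  rewrite lt_neqAle L1 andbT; apply/eqP => LE.
  by apply: Dw; rewrite -q1 -LE; apply: He; rewrite subrr euclidean_norm0.
have eC : 0 < e / C by rewrite divr_gt0.
pose l := Num.min 1 (L + e / C / 2).
have eC2 : 0 < e / C / 2 by rewrite divr_gt0.
have Ll : L < l by rewrite lt_min LN1 ltrDl.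
suff : l <= L by rewrite leNgt Ll.
apply: sup_upper_bound => //; split; first by rewrite (le_trans L0 (ltW Ll)) ge_min lexx.
apply/He/qd => //; rewrite gtr0_norm ?subr_gt0 // ltrBlDl gt_min.
by rewrite ltrD2l gtr_pMr // invf_lt1 // ltr1n orbT.
Qed.

(** This is 0 when the boundary is empty, where boundary_distance is infinite. *)
Definition real_distance D z : R := fine (boundary_distance D z).

Lemma boundary_distanceE D z : boundary D !=set0 ->
  boundary_distance D z = (real_distance D z)%:E.
Proof.
case=> w Dw; rewrite /real_distance fineK // fin_real //; apply/andP; split.
  apply: (@lt_le_trans _ _ 0%E) => //.
  by apply/ereal_infP => _ [p _ <-]; rewrite lee_fin euclidean_norm_ge0.
apply: (@le_lt_trans _ _ (euclidean_norm (z - w))%:E); last by rewrite ltry.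
by apply: ereal_inf_lbound; exists w.
Qed.

Lemma real_distance_le D z w : boundary D w -> real_distance D z <= euclidean_norm (z - w).
Proof.
move=> Dw; rewrite -lee_fin -boundary_distanceE; last by exists w.
by apply: ereal_inf_lbound; exists w.
Qed.

Lemma real_distance_ge D z c : boundary D !=set0 ->
  (forall w, boundary D w -> c <= euclidean_norm (z - w)) -> c <= real_distance D z.
Proof.
move=> D0 H; rewrite -lee_fin -boundary_distanceE //.
by apply/ereal_infP => _ [p Dp <-]; rewrite lee_fin H.
Qed.

Lemma real_distance_lipschitz D z w : boundary D !=set0 ->
  real_distance D z <= real_distance D w + euclidean_norm (z - w).
Proof.
move=> D0; rewrite -lerBlDr; apply: real_distance_ge => // p Dp.
rewrite lerBlDr addrC; apply: le_trans (real_distance_le _ _ _ Dp) _.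
exact: euclidean_dist_triangle.
Qed.

Lemma continuous_real_distance D z : boundary D !=set0 -> {for z, continuous (real_distance D)}.
Proof.
move=> D0; apply: nonexpansive_continuous => w.
have h1 := real_distance_lipschitz _ z w D0; have h2 := real_distance_lipschitz _ w z D0.
rewrite euclidean_dist_sym in h1; rewrite ler_norml; apply/andP; split; lra.
Qed.

Lemma boundary_open D w : open D -> boundary D w -> ~ D w.
Proof. by move=> oD [_ nD] Dw; apply: nD; rewrite /interior; exact: open_nbhs_nbhs. Qed.

Lemma real_distance_gt0 D z : boundary D !=set0 -> open D -> D z -> 0 < real_distance D z.
Proof.
move=> D0 oD Dz.
have /nbhs_euclideanP[e e0 He] : nbhs z D by exact: open_nbhs_nbhs.
apply: (lt_le_trans e0); apply: real_distance_ge => // w Dw.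
rewrite leNgt; apply/negP => ze; apply: (boundary_open _ _ oD Dw).
by apply: He; rewrite euclidean_dist_sym.
Qed.

Lemma real_distance_boundary D w : boundary D w -> real_distance D w <= 0.
Proof. by move=> Dw; have := real_distance_le D w w Dw; rewrite subrr euclidean_norm0. Qed.

Lemma boundary_nonempty D (M : R) : (0 < n)%N -> D !=set0 ->
  (forall z, D z -> euclidean_norm z <= M) -> boundary D !=set0.
Proof.
move=> n0 [z Dz] DM.
pose w : 'rV[R[i]]_n := const_mx (`|M| + 1)%:C%C.
have Dw : ~ D w.
  move=> /DM wM; have := le_trans (normc_le_euclidean_norm w (Ordinal n0)) wM.
  rewrite mxE normcR ger0_norm ?addr_ge0 // => h.
  by have := le_trans h (ler_norm M); rewrite gerDl ler10.
by have [l _ h] := segment_meets_boundary D z w Dz Dw; eexists; exact: h.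
Qed.

(** A segment from D to the boundary of E crosses the boundary of D, and the two
    pieces have lengths at least real_distance D z and c. *)
Lemma real_distance_super D E (c : R) z : boundary D !=set0 -> boundary E !=set0 ->
  open E -> D `<=` E -> (forall p, boundary D p -> c <= real_distance E p) ->
  D z -> real_distance D z + c <= real_distance E z.
Proof.
move=> D0 E0 oE DE H Dz; apply: real_distance_ge => // w Ew.
have Dw : ~ D w by move/DE; exact: boundary_open.
have [l /andP[l0 l1] Bp] := segment_meets_boundary D z w Dz Dw.
set p := z + _ in Bp.
have zp : euclidean_norm (z - p) = l * euclidean_norm (z - w).
  rewrite euclidean_dist_sym /p addrC addKr euclidean_normZ normcR ger0_norm //.
  by rewrite euclidean_dist_sym.
have pw : euclidean_norm (p - w) = (1 - l) * euclidean_norm (z - w).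
  have -> : p - w = (1 - l)%:C%C *: (z - w).
    rewrite /p rmorphB rmorph1 scalerBl scale1r !scalerBr opprB.
    by rewrite addrAC; congr (_ + _); rewrite opprB.
  by rewrite euclidean_normZ normcR ger0_norm // subr_ge0.
have h1 := real_distance_le _ z _ Bp.
have h2 := real_distance_le _ p _ Ew.
have h3 := H _ Bp.
rewrite zp in h1; rewrite pw in h2; lra.
Qed.

Lemma real_distance_super_le D E (c : R) z : boundary D !=set0 -> boundary E !=set0 ->
  (forall p, boundary D p -> real_distance E p <= c) ->
  real_distance E z <= real_distance D z + c.
Proof.
move=> D0 E0 H; rewrite -lerBlDr; apply: real_distance_ge => // p Dp.
have := real_distance_lipschitz _ z p E0; have := H p Dp; lra.
Qed.

End BoundaryDistance.

(** * Continuous, locally plurisubharmonic functions *)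

Section LocallyPsh.
Context {R : realType} {n : nat}.
Implicit Types (D : set 'rV[R[i]]_n) (f g u : 'rV[R[i]]_n -> R) (y z v : 'rV[R[i]]_n).

(** Plurisubharmonicity is local, but its definition by arbitrary closed discs does not
    show it. This local form is the one that can be glued; submean_local_global brings
    it back to the global one. *)
Definition locally_psh D f := forall y, D y ->
  {for y, continuous f} /\
  exists2 e : R, 0 < e & forall v, euclidean_norm v < e -> submean f y v.

Lemma open_euclidean_ball D y : open D -> D y ->
  exists2 e : R, 0 < e & forall z, euclidean_norm (z - y) < e -> D z.
Proof. by move=> oD Dy; apply/nbhs_euclideanP; exact: open_nbhs_nbhs. Qed.

Lemma euclidean_cis t y v : euclidean_norm (y + cis t *: v - y) = euclidean_norm v.
Proof. by rewrite addrC addKr euclidean_normZ normc_cis mul1r. Qed.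

Lemma locally_psh_subset D E f : D `<=` E -> locally_psh E f -> locally_psh D f.
Proof. by move=> DE Ef y /DE/Ef. Qed.

Lemma locally_psh_near D f : (forall y, D y -> exists2 g, locally_psh D g &
    \forall z \near y, g z = f z) -> locally_psh D f.
Proof.
move=> H y Dy; have [g gD /nbhs_euclideanP[e e0 He]] := H y Dy.
have [cg [e1 e10 He1]] := gD y Dy.
have fgy : g y = f y by apply: He; rewrite subrr euclidean_norm0.
split.
  apply/continuous_euclideanP => r r0.
  have [d d0 Hd] := (continuous_euclideanP _ _).1 cg r r0.
  exists (Num.min d e); first by rewrite lt_min d0.
  by move=> w; rewrite lt_min => /andP[wd we]; rewrite -fgy -He // Hd.
exists (Num.min e1 e); first by rewrite lt_min e10.
move=> v; rewrite lt_min => /andP[v1 ve].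
rewrite /submean -fgy (eq_circle_mean _ (fun t => g (y + cis t *: v))); first exact: He1.
by move=> t; rewrite He // euclidean_cis.
Qed.

Lemma locally_psh_affine D f (a b : R) : open D -> 0 <= a -> locally_psh D f ->
  locally_psh D (fun z => a * f z + b).
Proof.
move=> oD a0 fD y Dy; have [cf [e e0 He]] := fD y Dy; split.
  apply: (@continuous_comp _ _ _ f (fun x : R => a * x + b)) => //.
  have h : a * x @[x --> f y] --> a * f y by apply: cvgMr; exact: cvg_id.
  exact: (cvgD h (cvg_cst b)).
have [e1 e10 He1] := open_euclidean_ball D y oD Dy.
exists (Num.min e1 e); first by rewrite lt_min e10.
move=> v; rewrite lt_min => /andP[v1 ve].
have ch : continuous (fun t => f (y + cis t *: v)).
  by apply: continuous_circle_slice => t; apply: (fD _ _).1; apply: He1; rewrite euclidean_cis.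
rewrite /submean circle_meanD ?circle_mean_cst ?circle_meanZ //.
- by rewrite lerD2r ler_wpM2l //; exact: He.
- by move=> t; apply: cvgMr; exact: ch.
- by move=> t; exact: cvg_cst.
Qed.

Lemma locally_psh_max D f g : open D -> locally_psh D f -> locally_psh D g ->
  locally_psh D (fun z => Num.max (f z) (g z)).
Proof.
move=> oD fD gD.
have cm y : D y -> {for y, continuous (fun z => Num.max (f z) (g z))}.
  by move=> Dy; apply: continuous_max; [exact: (fD _ Dy).1|exact: (gD _ Dy).1].
move=> y Dy; split; first exact: cm.
have [_ [e e0 He]] := fD y Dy.
have [_ [e1 e10 He1]] := gD y Dy.
have [e2 e20 He2] := open_euclidean_ball D y oD Dy.
exists (Num.min e2 (Num.min e1 e)); first by rewrite !lt_min e10 e20.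
move=> v; rewrite !lt_min => /and3P[v2 v1 ve].
have inD t : D (y + cis t *: v) by apply: He2; rewrite euclidean_cis.
have cmv : continuous (fun t => Num.max (f (y + cis t *: v)) (g (y + cis t *: v))).
  exact: (continuous_circle_slice (fun z => Num.max (f z) (g z))) (fun t => cm _ (inD t)).
rewrite /submean ge_max; apply/andP; split.
  apply: le_trans (He v ve) _; apply: circle_mean_le => //.
    by apply: continuous_circle_slice => t; exact: (fD _ (inD t)).1.
  by move=> t _; rewrite le_max lexx.
apply: le_trans (He1 v v1) _; apply: circle_mean_le => //.
  by apply: continuous_circle_slice => t; exact: (gD _ (inD t)).1.
by move=> t _; rewrite le_max lexx orbT.
Qed.

Lemma locally_psh_cst D (c : R) : open D -> locally_psh D (fun=> c).
Proof.
move=> oD y Dy; split.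
  by apply/continuous_euclideanP => e e0; exists 1 => // w _; rewrite subrr normr0.
by exists 1 => // v _; rewrite /submean circle_mean_cst.
Qed.

(** On the overlap r < d < s the maximum is f itself, so the two branches agree
    there. *)
Lemma locally_psh_glue D f g (d : 'rV[R[i]]_n -> R) (r s : R) : open D -> r < s ->
  (forall y, D y -> {for y, continuous d}) ->
  locally_psh D f -> locally_psh D g ->
  (forall z, D z -> r < d z < s -> g z <= f z) ->
  locally_psh D (fun z => if d z < s then Num.max (f z) (g z) else f z).
Proof.
move=> oD rs cd fD gD gf; apply: locally_psh_near => y Dy.
have nD : \forall z \near y, D z by exact: open_nbhs_nbhs.
have [ds|sd] := ltP (d y) s.
  exists (fun z => Num.max (f z) (g z)); first exact: locally_psh_max.
  have : \forall z \near y, d z < s by exact: (cvgr_lt (d y) (cd y Dy)).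
  by apply: filterS => z ->.
exists f => //.
have : \forall z \near y, r < d z by apply: (cvgr_gt (d y) (cd y Dy)); exact: lt_le_trans sd.
apply: filterS2 nD => z Dz rz; case: ifP => // zs.
by rewrite max_l // gf // rz zs.
Qed.

End LocallyPsh.

Section Plurisubharmonicity.
Context {R : realType} {n : nat}.
Implicit Types (D : set 'rV[R[i]]_n) (f g u : 'rV[R[i]]_n -> R) (y z v : 'rV[R[i]]_n).

Lemma norm_normc (x : R[i]) : `|x| = (normc x)%:C%C.
Proof. by rewrite normc_def; case: x. Qed.

Lemma locally_psh_plurisubharmonic D f : open D -> locally_psh D f ->
  plurisubharmonic_on D (fun z => (f z)%:E).
Proof.
move=> oD fD; split.
- move=> x Dx a; rewrite lte_fin => fa.
  have : \forall y \near x, f y < a by exact: (cvgr_lt (f x) (fD x Dx).1).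
  by move=> h; apply: filterS h => y h _; rewrite lte_fin.
- by move=> z _; rewrite ltry.
move=> a b; split.
- move=> x Dx c; rewrite lte_fin => fc.
  have cf : {for x, continuous (fun x : R[i] => f (a + (1 * x) *: b))}.
    by apply: continuous_slice; apply: (fD _ _).1; rewrite mul1r.
  have : \forall y \near x, f (a + (1 * y) *: b) < c.
    by apply: (cvgr_lt _ cf); rewrite mul1r.
  by move=> h; apply: filterS h => y; rewrite mul1r => h _; rewrite lte_fin.
- by move=> x _; rewrite ltry.
move=> c r r0 H.
have disc (x : R[i]) : normc x <= 1 -> D (a + c *: b + x *: (r%:C%C *: b)).
  move=> x1; have := H (c + x * r%:C%C).
  rewrite addrC addKr norm_normc lecR normcM normcR gtr0_norm // ger_pMl // => /(_ x1) /=.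
  by rewrite scalerDl addrA scalerA.
have := submean_local_global D f (fun y Dy => (fD y Dy).1) (fun y Dy => (fD y Dy).2) _ _ disc.
rewrite /submean => hm.
have ch : continuous (fun t => f (a + c *: b + cis t *: (r%:C%C *: b))).
  by apply: continuous_circle_slice => t; apply: (fD _ _).1; apply: disc; rewrite normc_cis.
move: hm; rewrite -lee_fin circle_meanE // => hm.
apply: le_trans hm _; rewrite le_eqVlt; apply/orP; left; apply/eqP.
congr (_ * _)%E; apply: eq_integral => t _.
by rewrite scalerDl scalerA -addrA [_ * r%:C%C]mulrC.
Qed.

(** Inside D the distance is finite and positive, so the extended-real function of
    Oka's definition is a continuous real one. *)
Lemma pseudoconvex_locally_psh D : open D -> boundary D !=set0 -> pseudoconvex D ->
  locally_psh D (fun z => - ln (real_distance D z)).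
Proof.
move=> oD D0 [_ _ sD].
have cD y : D y -> {for y, continuous (fun z => - ln (real_distance D z))}.
  move=> Dy; apply: (@continuous_comp _ _ _ (real_distance D) (fun x : R => - ln x)).
    exact: continuous_real_distance.
  by apply: continuousN; apply: continuous_ln; exact: real_distance_gt0.
move=> y Dy; split; first exact: cD.
have [e e0 He] := open_euclidean_ball D y oD Dy.
exists e => // v ve.
have inD (x : R[i]) : normc x <= 1 -> D (y + x *: v).
  move=> x1; apply: He; rewrite addrC addKr euclidean_normZ; apply: le_lt_trans ve.
  by rewrite ler_piMl // euclidean_norm_ge0.
have lnE z : D z -> (- lne (boundary_distance D z))%E = (- ln (real_distance D z))%:E.
  by move=> Dz; rewrite boundary_distanceE // lne_EFin // real_distance_gt0.
have [_ _ /(_ 0 1 ltr01)] := sD y v.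
have H (x : R[i]) : `|x - 0| <= 1%:C%C -> D (y + x *: v).
  by rewrite subr0 norm_normc lecR; exact: inD.
move/(_ H).
rewrite scale0r addr0 lnE // /submean -lee_fin circle_meanE; last first.
  apply: (continuous_circle_slice (fun z => - ln (real_distance D z))) => t.
  by apply: cD; apply: inD; rewrite normc_cis.
move=> hm; apply: le_trans hm _; rewrite le_eqVlt; apply/orP; left; apply/eqP.
congr (_ * _)%E; apply: eq_integral => t _.
rewrite lnE.
  by rewrite add0r mul1r.
by rewrite add0r mul1r; apply: inD; rewrite normc_cis.
Qed.

End Plurisubharmonicity.

(** * Gluing a sequence of barriers into an exhaustion *)

Section Exhaustion.
Context {R : realType} {n : nat}.
Variables (Om : set 'rV[R[i]]_n) (d : 'rV[R[i]]_n -> R).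
Variables (t a : nat -> R) (w : nat -> 'rV[R[i]]_n -> R).

(** At stage k the function is at least - a k where d <= t k. The barrier w k is at
    most - 1 where d > t k / 2, so a k * w k can be glued in below d = t k, where it
    raises the lower bound to - a k.+1 on d <= t k.+1. *)
Fixpoint glued_psh (k : nat) : 'rV[R[i]]_n -> R :=
  if k is k'.+1 then fun z =>
    if d z < t k' then Num.max (glued_psh k' z) (a k' * w k' z) else glued_psh k' z
  else fun=> - 1.

Hypotheses (oOm : open Om) (cd : forall y, Om y -> {for y, continuous d}).
Hypotheses (d_gt0 : forall y, Om y -> 0 < d y) (t_gt0 : forall k, 0 < t k)
  (t_decr : forall k, t k.+1 < t k)
  (t_cvg : forall e, 0 < e -> exists k, t k <= e)
  (a0 : a 0%N = 1) (a_gt0 : forall k, 0 < a k)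
  (a_cvg : forall e, 0 < e -> exists k, a k <= e).
Hypotheses (w_psh : forall k, locally_psh Om (w k))
  (w_lt0 : forall k z, Om z -> w k z < 0)
  (w_leN1 : forall k z, Om z -> t k / 2 < d z -> w k z <= - 1)
  (w_ge : forall k z, Om z -> d z <= t k.+1 -> - a k.+1 <= a k * w k z).

Lemma glued_psh_props k : [/\ locally_psh Om (glued_psh k),
  (forall z, Om z -> glued_psh k z < 0) &
  (forall z, Om z -> d z <= t k -> - a k <= glued_psh k z)].
Proof.
elim: k => [|k [IH1 IH2 IH3]].
  split; first exact: locally_psh_cst.
    by move=> z _ /=; rewrite oppr_lt0.
  by move=> z _ _ /=; rewrite a0.
split.
- apply: (locally_psh_glue _ _ (fun z => a k * w k z) _ (t k / 2)) => //.
  + by rewrite gtr_pMr // invf_lt1 // ltr1n.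
  + have := locally_psh_affine _ _ (a k) 0 oOm (ltW (a_gt0 k)) (w_psh k).
    by under eq_fun do rewrite addr0.
  + move=> z Oz /andP[z1 z2]; apply: le_trans (IH3 z Oz (ltW z2)).
    by rewrite -[- a k]mulrN1 ler_pM2l //; exact: w_leN1.
- move=> z Oz /=; case: ifP => _; last exact: IH2.
  by rewrite gt_max IH2 // pmulr_rlt0 // w_lt0.
move=> z Oz dz /=; case: ifP => [_|/negbT].
  by rewrite le_max w_ge // orbT.
by rewrite -leNgt leNgt (le_lt_trans dz).
Qed.

Lemma glued_psh_homo j k z : Om z -> (j <= k)%N -> glued_psh j z <= glued_psh k z.
Proof.
move=> Oz /subnK <-; elim: (k - j)%N => [|i IH]; first by rewrite add0n.
by rewrite addSn /=; case: ifP => // _; rewrite le_max IH.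
Qed.

Lemma glued_psh_stable j k z : t j <= d z -> (j <= k)%N -> glued_psh k z = glued_psh j z.
Proof.
move=> tz /subnK <-; elim: (k - j)%N => [|i IH]; first by rewrite add0n.
rewrite addSn /=; case: ifP => // dz.
suff : t (i + j)%N <= t j by rewrite leNgt (le_lt_trans tz dz).
by elim: (i) => [|m IHm]; [rewrite add0n|rewrite addSn (le_trans _ IHm) // ltW].
Qed.

(** Each stage modifies the previous one only closer to the boundary, so the sequence
    is locally eventually constant and its limit inherits the local properties; it
    exceeds every stage, which yields the exhaustion property because a tends to 0. *)
Lemma glued_psh_exhaustion : exists rho : 'rV[R[i]]_n -> R,
  [/\ locally_psh Om rho, (forall z, Om z -> rho z < 0) &
      forall c, 0 < c -> exists2 s, 0 < s & forall z, Om z -> rho z < - c -> s <= d z].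
Proof.
have /choice[K HK] : forall z, exists k, Om z -> t k <= d z.
  move=> z; have [Oz|nOz] := pselect (Om z); last by exists 0%N.
  by have [k hk] := t_cvg _ (d_gt0 _ Oz); exists k.
pose rho z := glued_psh (K z) z.
have rhoE k z : Om z -> t k <= d z -> rho z = glued_psh k z.
  move=> Oz tk; rewrite /rho; have [kK|Kk] := leqP k (K z).
    exact: glued_psh_stable.
  by rewrite (glued_psh_stable _ _ _ (HK z Oz) (ltnW Kk)).
have rho_ge k z : Om z -> glued_psh k z <= rho z.
  move=> Oz; have [kK|Kk] := leqP k (K z); first exact: glued_psh_homo.
  by rewrite (glued_psh_stable _ _ _ (HK z Oz) (ltnW Kk)).
exists rho; split.
- apply: locally_psh_near => y Oy.
  have dy := d_gt0 _ Oy.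
  have [k hk] : exists k, t k <= d y / 2 by apply: t_cvg; rewrite divr_gt0.
  exists (glued_psh k); first by have [] := glued_psh_props k.
  have n1 : \forall z \near y, Om z by exact: open_nbhs_nbhs.
  have : \forall z \near y, d y / 2 < d z.
    by apply: (cvgr_gt (d y) (cd y Oy)); rewrite gtr_pMr // invf_lt1 // ltr1n.
  apply: filterS2 n1 => z Oz dz; rewrite (rhoE k) //.
  exact: le_trans hk (ltW dz).
- by move=> z Oz; have [_ + _] := glued_psh_props (K z); apply.
move=> c c0; have [k hk] := a_cvg _ c0; exists (t k) => // z Oz rc.
rewrite leNgt; apply/negP => dz.
have [_ _ /(_ z Oz (ltW dz)) h] := glued_psh_props k.
have := le_trans h (rho_ge k z Oz); rewrite leNgt (lt_le_trans rc) //.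
by rewrite lerN2.
Qed.

End Exhaustion.

(** * Divergence of the logarithmic weights *)

Section Blocks.
Context {R : realType}.
Notation mu := (@lebesgue_measure R).

Lemma ge0_integral_oc_split (f : R -> R) (a b c : R) : a <= b -> b <= c ->
  measurable_fun `]a, c] f -> (forall x, a < x <= c -> 0 <= f x) ->
  (\int[mu]_(x in `]a, c]) (f x)%:E =
   \int[mu]_(x in `]a, b]) (f x)%:E + \int[mu]_(x in `]b, c]) (f x)%:E)%E.
Proof.
move=> ab bc mf f0.
have E : `]a, c]%classic = `]a, b] `|` `]b, c].
  by rewrite -itv_bndbnd_setU // bnd_simp.
have memE x : (`]a, b] `|` `]b, c]) x -> a < x <= c by rewrite -E /= in_itv.
rewrite E ge0_integral_setU //.
- by rewrite -E; apply/measurable_EFinP.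
- by move=> x /memE xac; rewrite lee_fin f0.
- apply/disj_setPS => x /= []; rewrite !in_itv /= => /andP[_ xb] /andP[bx _].
  by move: bx; rewrite ltNge xb.
Qed.

(** Bounding the integral block by block along the sequence r / 8 ^+ k, and passing to
    the limit by monotone convergence. *)
Lemma integral_geometric_blocks (f : R -> R) (r B : R) (c : nat -> R) : 0 < r ->
  measurable_fun `]0, r] f -> (forall x, 0 < x <= r -> 0 <= f x) ->
  (forall k x, r / 8 ^+ k.+1 < x <= r / 8 ^+ k -> f x * (r / 8 ^+ k - r / 8 ^+ k.+1) <= c k) ->
  (forall N, \sum_(k < N) c k <= B) ->
  (\int[mu]_(x in `]0%R, r]) (f x)%:E <= B%:E)%E.
Proof.
move=> r0 mf f0 fc cB.
pose t k := r / 8 ^+ k.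
have t0 k : 0 < t k by rewrite divr_gt0 // exprn_gt0.
have tS k : t k.+1 < t k.
  by rewrite /t exprS invfM mulrCA gtr_pMl ?t0 // invf_lt1 // ltr1n.
have tr k : t k <= r by rewrite ler_pdivrMr ?exprn_gt0 // ler_peMr ?(ltW r0) // exprn_ege1 // ler1n.
have sub k : `]t k, r] `<=` `]0, r].
  by move=> x /=; rewrite !in_itv /= => /andP[tx ->]; rewrite (lt_trans (t0 k)).
have mfk k : measurable_fun `]t k, r] f by apply: measurable_funS mf => //; exact: sub.
have f0k k x : t k < x <= r -> 0 <= f x.
  by move=> /andP[tx xr]; apply: f0; rewrite xr (lt_trans (t0 k)).
have E : `]0, r]%classic = \bigcup_k `]t k, r]%classic.
  apply/seteqP; split=> x /=; last by case=> k _; exact: sub.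
  rewrite in_itv /= => /andP[x0 xr].
  exists (Num.truncn (r / x)) => //=; rewrite in_itv /= xr andbT.
  rewrite /t ltr_pdivrMr ?exprn_gt0 // mulrC -ltr_pdivrMr //.
  apply: lt_le_trans (truncnS_gt _) _.
  by rewrite -natrX ler_nat (leq_trans _ (ltn_expl _ _)).
rewrite E.
have step N : (\int[mu]_(x in `]t N, r]) (f x)%:E <= (\sum_(k < N) c k)%:E)%E.
  elim: N => [|N IH].
    by rewrite /t expr0 divr1 set_itvoc0 integral_set0 big_ord0.
  rewrite (ge0_integral_oc_split f _ (t N)) ?(ltW (tS N)) ?tr //; last exact: f0k.
  rewrite big_ord_recr /= EFinD addeC leeD //.
  have -> : (c N)%:E = (\int[mu]_(x in `]t N.+1, t N]) (c N / (t N - t N.+1))%:E)%E.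
    rewrite integral_cst //= lebesgue_measure_itv /= lte_fin tS -EFinB -EFinM mulfVK //.
    by rewrite gt_eqF // subr_gt0.
  apply: ge0_le_integral => //=.
  - move=> x; rewrite in_itv /= => /andP[x1 x2]; rewrite lee_fin (f0k N.+1) // x1.
    exact: le_trans (tr N).
  - apply/measurable_EFinP; apply: measurable_funS (mfk N.+1) => //.
    by move=> x /=; rewrite !in_itv /= => /andP[-> x2]; exact: le_trans (tr N).
  - move=> x; rewrite in_itv /= => xN; rewrite lee_fin ler_pdivlMr ?subr_gt0 //.
    exact: fc.
have cvgJ : (\int[mu]_(x in `]t N, r]) (f x)%:E)%E @[N --> \oo] -->
    (\int[mu]_(x in \bigcup_N `]t N, r]%classic) (f x)%:E)%E.
  apply: (@ge0_nondecreasing_set_cvg_integral _ (measurableTypeR R) R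
    (fun N => `]t N, r]%classic) (EFin \o f) [the measure _ _ of mu]) => //.
  - apply/nondecreasing_seqP => k; apply/subsetPset => x /=; rewrite !in_itv /=.
    by move=> /andP[x1 xr]; apply/andP; split=> //; exact: lt_trans x1.
  - by move=> k; apply/measurable_EFinP; exact: mfk.
rewrite -(cvg_lim _ cvgJ) //; apply: lime_le; first by apply/cvg_ex; eexists; exact: cvgJ.
by apply: nearW => N; apply: le_trans (step N) _; rewrite lee_fin.
Qed.

End Blocks.

Section Divergence.
Context {R : realType}.
Notation mu := (@lebesgue_measure R).
Variables (eta : R -> R) (r0 : R).
Hypotheses (r0_gt0 : 0 < r0)
  (eta_cont : {within `]0, r0], continuous eta})
  (eta_homo : {in `]0, r0] &, {homo eta : s t / s <= t}})
  (eta_bd : forall t, 0 < t <= r0 -> 0 < eta t < t).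

Definition log_ratio t := ln (t / eta t).
Definition log_integrand t := (t * log_ratio t)^-1.

Lemma log_ratio_gt0 t : 0 < t <= r0 -> 0 < log_ratio t.
Proof.
move=> tr; have /andP[e0 et] := eta_bd t tr.
by rewrite /log_ratio ln_gt0 // ltr_pdivlMr // mul1r.
Qed.

Lemma log_integrand_continuous : {within `]0, r0], continuous log_integrand}.
Proof.
rewrite continuous_subspace_in => t /[!inE] /= ; rewrite in_itv /= => tr.
have /andP[e0 et] := eta_bd t tr.
have t0 : 0 < t by case/andP: tr.
have cid : {for t, continuous (id : subspace `]0, r0] -> R)}.
  by apply: continuous_subspaceT => x; exact: cvg_id.
have ce := eta_cont t.
apply: cvgV; first by rewrite gt_eqF // mulr_gt0 // log_ratio_gt0.
apply: cvgM; first exact: cid.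
have h : {for t, continuous (fun x : subspace `]0, r0] => x / eta x)}.
  apply: cvgM; first exact: cid.
  by apply: cvgV; [rewrite gt_eqF|exact: ce].
have hl : {for t / eta t, continuous (@ln R)} by apply: continuous_ln; rewrite divr_gt0.
exact: (cvg_comp _ _ h hl).
Qed.

(** The relative gain obtained at t = r0 / 8 ^+ k:
    1 - log_weight k = ln (2 t / eta t) / ln (4 t / eta t). *)
Definition log_weight k : R := ln 2 / (2 * ln 2 + log_ratio (r0 / 8 ^+ k)).

(** If the sums were bounded, the weights would tend to 0, so that log_ratio exceeds
    6 ln 2 at late points t k of the sequence. As eta is nondecreasing, log_ratio loses
    at most ln 8 = 3 ln 2, hence at most half, from t k down to t k.+1. The integral over
    that block is then at most a constant times log_weight k, and the whole integral
    would converge. *)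
Lemma log_weight_unbounded :
  (\int[mu]_(t in `]0%R, r0]) (log_integrand t)%:E = +oo)%E ->
  forall B, exists N, B <= \sum_(k < N) log_weight k.+1.
Proof.
move=> foo B; apply: contrapT => /forallNP nB.
have {}nB N : \sum_(k < N) log_weight k.+1 <= B.
  by have /negP := nB N; rewrite -ltNge => /ltW.
pose t k := r0 / 8 ^+ k.
have t0 k : 0 < t k by rewrite divr_gt0 // exprn_gt0.
have tS k : t k = 8 * t k.+1.
  by rewrite /t exprS invfM mulrCA mulVKf.
have tr k : 0 < t k <= r0.
  by rewrite t0 ler_pdivrMr ?exprn_gt0 // ler_peMr ?(ltW r0_gt0) // exprn_ege1 // ler1n.
have ln2 : 0 < ln 2 :> R by rewrite ln_gt0 // ltr1n.
have den k : 0 < 2 * ln 2 + log_ratio (t k) by rewrite addr_gt0 ?mulr_gt0 // log_ratio_gt0.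
have c0 k : 0 < log_weight k by rewrite divr_gt0 // den.
have [K HK] : exists K, forall k, (K <= k)%N -> log_weight k.+1 < 8^-1.
  have : cvgn (series (fun k => log_weight k.+1)).
    apply: nondecreasing_is_cvgn.
      by apply/nondecreasing_seqP => k; rewrite /series /= big_nat_recr //= lerDl ltW.
    by exists B => _ [k _ <-]; rewrite /series /= big_mkord.
  move/cvg_series_cvg_0/cvgr_lt => /(_ 8^-1); rewrite invr_gt0 ltr0n => /(_ isT) [K _ HK].
  by exists K => k; exact: HK.
pose r1 := t K.+1.
have /andP[r10 r1r] : 0 < r1 <= r0 := tr _.
have mf : measurable_fun `]0, r0] log_integrand.
  by apply: subspace_continuous_measurable_fun => //; exact: log_integrand_continuous.
have f0 x : 0 < x <= r0 -> 0 <= log_integrand x.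
  by move=> xr; rewrite invr_ge0 mulr_ge0 ?ltW ?log_ratio_gt0 //; case/andP: xr.
(* On the block below t k the integrand is at most (t k.+1 * log_ratio (t k) / 2)^-1 and
   the length is 7 t k.+1; since 2 ln 2 <= log_ratio (t k), the product
   14 / log_ratio (t k) is at most 28 / ln 2 * log_weight k. *)
have h1 : (\int[mu]_(x in `]0%R, r1]) (log_integrand x)%:E <= (28 / ln 2 * B)%:E)%E.
  apply: (integral_geometric_blocks log_integrand r1 _
    (fun m => 28 / ln 2 * log_weight (K + m).+1)) => //.
  - apply: measurable_funS mf => // x /=; rewrite !in_itv /= => /andP[-> x1].
    exact: le_trans r1r.
  - by move=> x /andP[x0 x1]; apply: f0; rewrite x0 (le_trans x1).
  - move=> m x; rewrite -!mulrA -!invfM -!exprD !addSn addnS => /andP[x1 x2].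
    pose k := (K + m).+1; rewrite -/(t k) -/(t k.+1) in x1 x2 *; rewrite [28 * (_ * _)]mulrA.
    have xr : 0 < x <= r0.
      by rewrite (lt_trans (t0 _) x1) (le_trans x2) //; case/andP: (tr k).
    have /andP[x0 _] := xr.
    have /andP[ex0 exx] := eta_bd x xr.
    have /andP[ek0 ekk] := eta_bd (t k) (tr k).
    have ee : eta x <= eta (t k) by apply: eta_homo => //; rewrite in_itv /= ?xr ?tr.
    have Lx : log_ratio (t k) - 3 * ln 2 <= log_ratio x.
      have -> : log_ratio (t k) - 3 * ln 2 = ln (t k.+1 / eta (t k)).
        rewrite /log_ratio {1}(tS k) -mulrA lnM ?posrE ?divr_gt0 //.
        have -> : ln 8 = 3 * ln 2 :> R.
          by rewrite mulrC mulr_natr -lnXn //; congr ln; rewrite -natrX.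
        by rewrite addrC addKr.
      rewrite /log_ratio ler_ln ?posrE ?divr_gt0 //.
      apply: ler_pM; [exact: ltW|by rewrite invr_ge0 ltW|exact: ltW|by rewrite lef_pV2 ?posrE].
    have Lk : 6 * ln 2 < log_ratio (t k).
      have := HK (K + m)%N (leq_addr _ _); rewrite /log_weight -/(t k) ltr_pdivrMr ?den //.
      lra.
    have Lx2 : log_ratio (t k) / 2 <= log_ratio x by lra.
    have tk : t k - t k.+1 = 7 * t k.+1 by rewrite tS; ring.
    rewrite tk /log_weight -/(t k).
    have Lk0 : 0 < log_ratio (t k) by rewrite log_ratio_gt0.
    apply: (@le_trans _ _ ((t k.+1 * (log_ratio (t k) / 2))^-1 * (7 * t k.+1))).
      apply: ler_wpM2r; first by rewrite mulr_ge0 // ltW.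
      rewrite /log_integrand lef_pV2 ?posrE ?mulr_gt0 ?log_ratio_gt0 //.
      by apply: ler_pM => //; rewrite ?divr_ge0 ?(ltW (t0 _)) ?(ltW Lk0) // ltW.
    have -> : (t k.+1 * (log_ratio (t k) / 2))^-1 * (7 * t k.+1) = 14 / log_ratio (t k).
      by field; rewrite !gt_eqF.
    have -> : 28 / ln 2 * (ln 2 / (2 * ln 2 + log_ratio (t k))) = 28 / (2 * ln 2 + log_ratio (t k)).
      by field; rewrite !gt_eqF.
    rewrite ler_pdivrMr // mulrAC ler_pdivlMr ?den //; lra.
  - move=> N; rewrite -mulr_sumr ler_pM2l ?divr_gt0 //.
    apply: le_trans (nB (K + N)%N).
    rewrite big_split_ord /= lerDr sumr_ge0 // => k _.
    exact: ltW.
have h2 : (\int[mu]_(x in `]r1, r0]) (log_integrand x)%:E < +oo)%E.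
  have mu_fi : mu.-integrable `[r1, r0] (EFin \o log_integrand).
    apply: continuous_compact_integrable; first exact: segment_compact.
    apply: continuous_subspaceW log_integrand_continuous => x /=.
    by rewrite !in_itv /= => /andP[x1 ->]; rewrite (lt_le_trans r10).
  have /integrable_fin_num h : mu.-integrable `]r1, r0] (EFin \o log_integrand).
    by apply: (@integrableS _ _ _ mu `[r1, r0]) => //; exact: subset_itv_oc_cc.
  by rewrite ltey_eq h.
have := ge0_integral_oc_split log_integrand 0 r1 r0 (ltW r10) r1r mf f0.
rewrite foo => E; have : (+oo < +oo :> \bar R)%E.
  by rewrite {1}E lte_add_pinfty // (le_lt_trans h1) // ltry.
by rewrite ltxx.
Qed.

End Divergence.

Lemma prod_onem_vanishes {R : realType} (c : nat -> R) :
  (forall k, 0 < c k < 1) -> (forall B, exists N, B <= \sum_(k < N) c k) ->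
  forall e : R, 0 < e -> exists N, \prod_(k < N) (1 - c k) <= e.
Proof.
move=> c01 cB e e0; have [N HN] := cB (- ln e); exists N.
apply: (@le_trans _ _ (expR (- \sum_(k < N) c k))).
  elim: N {HN} => [|N IH]; first by rewrite !big_ord0 oppr0 expR0.
  rewrite !big_ord_recr /= opprD expRD; apply: ler_pM => //.
  - by apply: prodr_ge0 => k _; have /andP[_ c1] := c01 k; rewrite subr_ge0 ltW.
  - by have /andP[_ c1] := c01 N; rewrite subr_ge0 ltW.
  - exact: expR_ge1Dx.
by rewrite -[X in _ <= X]lnK ?posrE // ler_expR lerNl.
Qed.

(** * Hyperconvexity *)

Section Hyperconvexity.
Context {R : realType} {n : nat}.
Implicit Types (Om : set 'rV[R[i]]_n) (f : 'rV[R[i]]_n -> R).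

Lemma closure_ge (A : set 'rV[R[i]]_n) f (c : R) z : {for z, continuous f} ->
  (forall a, A a -> c <= f a) -> closure A z -> c <= f z.
Proof.
move=> cf H cA; rewrite leNgt; apply/negP => fc.
have /cA[a [Aa]] : \forall y \near z, f y < c by exact: (cvgr_lt (f z) cf).
by rewrite ltNge H.
Qed.

(** Where the real distance is bounded below, the closure stays away from the boundary,
    hence in the domain, and it is compact because the domain is bounded. *)
Lemma hyperconvex_of_exhaustion Om (M : R) rho : is_domain Om -> bounded_set Om ->
  (forall z, Om z -> euclidean_norm z <= M) -> boundary Om !=set0 ->
  locally_psh Om rho -> (forall z, Om z -> rho z < 0) ->
  (forall c, 0 < c -> exists2 s, 0 < s &
     forall z, Om z -> rho z < - c -> s <= real_distance Om z) ->
  hyperconvex Om.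
Proof.
move=> Omd Omb OmM B0 rpsh r0 ex; have [_ oOm _] := Omd.
split=> //; exists rho; split=> //.
- by apply: continuous_in_subspaceT => z /[!inE] Oz; exact: (rpsh z Oz).1.
- exact: locally_psh_plurisubharmonic.
move=> c c0; have [s s0 Hs] := ex c c0.
set A := [set z | _]; split.
  apply: (@compact_closed_bounded _ _ _ M); first exact: closed_closure.
  move=> z; rewrite -lerN2; apply: (closure_ge _ (fun z => - euclidean_norm z)).
    apply: nonexpansive_continuous => w.
    have h1 := euclidean_normD (z - w) w; have h2 := euclidean_normD (w - z) z.
    rewrite !subrK in h1 h2; rewrite (euclidean_dist_sym z w) in h1.
    by rewrite opprK ler_norml; apply/andP; split; lra.
  by move=> a [/OmM Oa _]; rewrite lerN2.
move=> z cA; have sz : s <= real_distance Om z.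
  apply: (closure_ge A) cA; first exact: continuous_real_distance.
  by move=> a [Oa ra]; exact: Hs.
apply: contrapT => nOz.
have Bz : boundary Om z.
  split; last by move/interior_subset.
  by apply: closureS cA => a [].
by have := le_trans sz (real_distance_boundary _ _ Bz); rewrite leNgt s0.
Qed.

End Hyperconvexity.

Theorem proposition5p1 (R : realType) (n : nat) (n_gt0 : (0 < n)%N)
  (Om : set 'rV[R[i]]_n)
  (Om_domain : is_domain Om) (Om_bounded : bounded_set Om)
  (Om_pseudoconvex : pseudoconvex Om)
  (t0 : R) (t0_gt0 : 0 < t0)
  (Omt : R -> set 'rV[R[i]]_n)
  (Omt_domain : forall t : R, 0 < t <= t0 -> is_domain (Omt t))
  (Omt_pseudoconvex : forall t : R, 0 < t <= t0 -> pseudoconvex (Omt t))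
  (Om_sub : forall t : R, 0 < t <= t0 -> closure Om `<=` Omt t)
  (eta : R -> R)
  (eta_continuous : {within `]0, t0], continuous eta})
  (eta_increasing : {in `]0, t0] &, {homo eta : s t / s <= t}})
  (eta_bounds : forall t : R, 0 < t <= t0 -> 0 < eta t < t)
  (Omt_distance : forall t : R, 0 < t <= t0 -> forall z : 'rV[R[i]]_n, boundary Om z ->
     ((eta t)%:E <= boundary_distance (Omt t) z <= t%:E)%E)
  (r0 : R) (r0_bounds : 0 < r0 <= t0)
  (eta_integral :
     (\int[@lebesgue_measure R]_(t in `]0%R, r0]%classic)
        ((t * ln (t / eta t))^-1)%R%:E = +oo)%E) :
  hyperconvex Om.
Proof.
have [Om0 oOm _] := Om_domain.
have [M OmM] := bounded_euclidean _ _ Om_bounded.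
have B0 := boundary_nonempty _ _ n_gt0 Om0 OmM.
have /andP[r0_gt0 r0t0] := r0_bounds.
have wide x : 0 < x <= r0 -> 0 < x <= t0.
  by move=> /andP[-> xr]; exact: le_trans r0t0.
have ec : {within `]0, r0], continuous eta}.
  by apply: continuous_subspaceW eta_continuous => x /=; rewrite !in_itv; exact: wide.
have eh : {in `]0, r0] &, {homo eta : s t / s <= t}}.
  by move=> x y; rewrite !in_itv => xr yr; apply: eta_increasing; rewrite in_itv; exact: wide.
have eb x : 0 < x <= r0 -> 0 < eta x < x by move/wide/eta_bounds.
have Bt x : 0 < x <= r0 -> boundary (Omt x) !=set0.
  move=> /wide xr; apply/set0P/eqP => B; have [p Bp] := B0.
  have /andP[_] := Omt_distance x xr p Bp.
  by rewrite /boundary_distance B image_set0 ereal_inf0 leye_eq.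
have Bd x p : 0 < x <= r0 -> boundary Om p -> eta x <= real_distance (Omt x) p <= x.
  move=> xr Bp; have := Omt_distance x (wide x xr) p Bp.
  by rewrite boundary_distanceE ?lee_fin //; exact: Bt.
have sub x : 0 < x <= r0 -> Om `<=` Omt x.
  by move=> /wide xr z Oz; apply: Om_sub => //; exact: subset_closure.
have op x : 0 < x <= r0 -> open (Omt x) by move=> /wide/Omt_domain[].
pose t k := r0 / 8 ^+ k.
have t_gt0 k : 0 < t k by rewrite divr_gt0 // exprn_gt0.
have tS k : t k = 8 * t k.+1 by rewrite /t exprS invfM mulrCA mulVKf.
have tr k : 0 < t k <= r0.
  by rewrite t_gt0 ler_pdivrMr ?exprn_gt0 // ler_peMr ?(ltW r0_gt0) // exprn_ege1 // ler1n.
pose d := real_distance Om; pose dt k := real_distance (Omt (t k.+1)).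
have d_gt0 z : Om z -> 0 < d z by exact: real_distance_gt0.
have dt_ge k z : Om z -> d z + eta (t k.+1) <= dt k z.
  move=> Oz; apply: real_distance_super => //; [exact: Bt|exact: op|exact: sub|].
  by move=> p Bp; have /andP[] := Bd _ _ (tr k.+1) Bp.
have dt_le k z : dt k z <= d z + t k.+1.
  apply: real_distance_super_le => //; first exact: Bt.
  by move=> p Bp; have /andP[] := Bd _ _ (tr k.+1) Bp.
have et0 k : 0 < eta (t k) by have /andP[] := eb _ (tr k).
have ett k : eta (t k) < t k by have /andP[] := eb _ (tr k).
have dt_gt0 k z : Om z -> 0 < dt k z.
  by move=> Oz; apply: lt_le_trans (dt_ge k z Oz); rewrite addr_gt0 // d_gt0.
have ln2 : 0 < ln 2 :> R by rewrite ln_gt0 // ltr1n.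
have ln4 : ln 4 = 2 * ln 2 :> R by rewrite mulrC mulr_natr -lnXn //; congr ln; rewrite -natrX.
pose L k := ln (t k) - ln (eta (t k)).
have L_gt0 k : 0 < L k by rewrite subr_gt0 ltr_ln ?posrE.
pose K k := 2 * ln 2 + L k.+1.
have K_gt0 k : 0 < K k by rewrite addr_gt0 // mulr_gt0.
(* (ln eta - ln dt) / ln (4 t / eta) at t = t k.+1, written as an affine function of
   - ln dt to show that it is plurisubharmonic. *)
pose w k z := (K k)^-1 * - ln (dt k z) + (K k)^-1 * ln (eta (t k.+1)).
have wE k z : w k z = (ln (eta (t k.+1)) - ln (dt k z)) / K k by rewrite /w; ring.
pose c k := log_weight eta r0 k.+1.
have cE k : c k = ln 2 / K k by rewrite /c /log_weight /log_ratio -/(t k.+1) ln_div ?posrE.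
have c01 k : 0 < c k < 1.
  rewrite cE divr_gt0 //= ltr_pdivrMr // mul1r /K.
  have := L_gt0 k.+1; lra.
(* 1 - c k = ln (2 t / eta) / ln (4 t / eta) at t = t k.+1. *)
pose a k := \prod_(i < k) (1 - c i).
have a_gt0 k : 0 < a k by apply: prodr_gt0 => i _; rewrite subr_gt0; have /andP[] := c01 i.
have [rho [rpsh r_lt0 rex]] : exists rho : 'rV[R[i]]_n -> R,
  [/\ locally_psh Om rho, (forall z, Om z -> rho z < 0) &
      forall c, 0 < c -> exists2 s, 0 < s & forall z, Om z -> rho z < - c -> s <= d z].
  apply: (glued_psh_exhaustion Om d t a w) => //.
  - by move=> y _; exact: continuous_real_distance.
  - by move=> k; rewrite (tS k) ltr_pMl // ltr1n.
  - move=> e e0; exists (Num.truncn (r0 / e)).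
    rewrite /t ler_pdivrMr ?exprn_gt0 // mulrC -ler_pdivrMr //.
    apply: ltW; apply: lt_le_trans (truncnS_gt _) _.
    by rewrite -natrX ler_nat (leq_trans _ (ltn_expl _ _)).
  - by rewrite /a big_ord0.
  - apply: prod_onem_vanishes => //.
    exact: (log_weight_unbounded eta r0 r0_gt0 ec eh eb eta_integral).
  - move=> k; apply: locally_psh_affine => //; first by rewrite invr_ge0 ltW.
    apply: (locally_psh_subset _ (Omt (t k.+1))); first exact: sub.
    by apply: pseudoconvex_locally_psh; [exact: op|exact: Bt|exact/Omt_pseudoconvex/wide].
  - move=> k z Oz; rewrite wE pmulr_llt0 ?invr_gt0 // subr_lt0 ltr_ln ?posrE ?dt_gt0 //.
    by apply: lt_le_trans (dt_ge k z Oz); rewrite ltrDr d_gt0.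
  - move=> k z Oz; rewrite (tS k) => dz; rewrite wE ler_pdivrMr // mulN1r.
    have : ln (4 * t k.+1) <= ln (dt k z).
      rewrite ler_ln ?posrE ?mulr_gt0 ?dt_gt0 //.
      have := dt_ge k z Oz; have := et0 k.+1; lra.
    by rewrite lnM ?posrE // ln4 /K /L; lra.
  move=> k z Oz dz; rewrite /a big_ord_recr /= -/(a k) -mulrN ler_pM2l // wE cE.
  rewrite ler_pdivlMr // opprB mulrBl mul1r divfK ?gt_eqF //.
  have : ln (dt k z) <= ln (2 * t k.+1).
    rewrite ler_ln ?posrE ?mulr_gt0 ?dt_gt0 //.
    have := dt_le k z; lra.
  by rewrite lnM ?posrE // /K /L; lra.
exact: (hyperconvex_of_exhaustion Om M rho).
Qed.
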